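(* Let $G$ be a non-amenable discrete group acting freely by homeomorphisms on a compact Hausdorff space $X$, and suppose that $X$ admits a $G$-invariant regular Borel probability measure. Then the opaque ideal and the gray ideal relative to the inclusion $(C(X)\rtimes_f G,\,C(X))$ coincide and are non-zero.
   Context: An action of $G$ on $X$ is free if $sx\neq x$ for every $x\in X$ and every $e\neq s\in G$. With $\tau_s(a)(x)=a(s^{-1}x)$ for $a\in C(X)$, $C_c(G,C(X))$ is the $*$-algebra of finitely supported functions $G\to C(X)$ with $(ab)(t)=\sum_{s}a(s)\tau_s(b(s^{-1}t))$ and $a^*(t)=\tau_t(a(t^{-1}))^*$; $C(X)$ is the subalgebra of functions supported at $e$. $C(X)\rtimes_f G$ is the full crossed product (the completion of $C_c(G,C(X))$ in the largest $C^*$-norm). Let $\mathcal A=C(X)\subseteq\mathcal B$ be unital $C^*$-algebras with the same unit, such that the inclusion is regular, i.e. the linear span of $\{v\in\mathcal B: v\mathcal Av^*\cup v^*\mathcal Av\subseteq\mathcal A\}$ is dense in $\mathcal B$ (this holds for $\mathcal B=C(X)\rtimes_fG$). For $x\in X$ put $J_x=\{f\in C(X): f(x)=0\}$ and let $J_x\mathcal B$ be the closed linear span of $\{ab: a\in J_x,\ b\in\mathcal B\}$. The opaque ideal of $(\mathcal B,\mathcal A)$ is $\bigcap_{x\in X}J_x\mathcal B$. The gray ideal is $\bigcap_{x\in F}J_x\mathcal B$, where $F$ is the set of all $x\in X$ (free points) for which the evaluation functional $f\mapsto f(x)$ on $C(X)$ has a unique pure state extension to $\mathcal B$. Both are closed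 two-sided ideals of $\mathcal B$. *)

(* Defs.v *)
From HB Require Import structures.
From mathcomp Require Import all_boot all_order all_algebra.
From mathcomp Require Import complex.
From mathcomp Require Import all_classical all_reals all_analysis.

Set Implicit Arguments.
Unset Strict Implicit.
Unset Printing Implicit Defensive.

Import Order.TTheory GRing.Theory Num.Theory.
Import numFieldNormedType.Exports.

Local Open Scope classical_set_scope.
Local Open Scope complex_scope.
Local Open Scope ring_scope.

(* No topology is attached to R[i] in the libraries: take that of the modulus. *)
HB.instance Definition _ (R : realType) := NormedModule.copy R[i] R[i]^o.

(* The norm of a normed module over R[i] takes its values in R[i]; they are
   nonnegative, hence real, for the partial order of R[i].

   The hierarchy has no join of rings and normed spaces, so the product is a
   field of the mixin, and the ring and algebra structures are recovered by the
   instances that follow the structure. *)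
HB.mixin Record isCStarAlgebra (R : realType) A
    & CompleteNormedModule R[i] A := {
  cstar_one : A;
  cstar_mul : A -> A -> A;
  star : A -> A;
  cstar_mulA : associative cstar_mul;
  cstar_mul1l : left_id cstar_one cstar_mul;
  cstar_mul1r : right_id cstar_one cstar_mul;
  cstar_mulDl : left_distributive cstar_mul +%R;
  cstar_mulDr : right_distributive cstar_mul +%R;
  cstar_mulZl : forall (c : R[i]) (a b : A),
    c *: cstar_mul a b = cstar_mul (c *: a) b;
  cstar_mulZr : forall (c : R[i]) (a b : A),
    c *: cstar_mul a b = cstar_mul a (c *: b);
  cstar_one_neq0 : cstar_one != 0;
  starK : involutive star;
  starD : {morph star : a b / a + b};
  starZ : forall (c : R[i]) (a : A), star (c *: a) = c^* *: star a;
  starM : forall a b : A, star (cstar_mul a b) = cstar_mul (star b) (star a);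
  cstar_normM : forall a b : A, `|cstar_mul a b| <= `|a| * `|b|;
  cstar_normX : forall a : A, `|cstar_mul (star a) a| = `|a| ^+ 2
}.

#[short(type="cstarAlgType")]
HB.structure Definition CStarAlgebra (R : realType) :=
  {A of isCStarAlgebra R A & CompleteNormedModule R[i] A}.

Section cstar_ring.
Variables (R : realType) (A : cstarAlgType R).

#[non_forgetful_inheritance]
HB.instance Definition _ := GRing.Zmodule_isNzRing.Build A
  cstar_mulA cstar_mul1l cstar_mul1r cstar_mulDl cstar_mulDr cstar_one_neq0.
#[non_forgetful_inheritance]
HB.instance Definition _ := GRing.Lmodule_isLalgebra.Build R[i] A cstar_mulZl.
#[non_forgetful_inheritance]
HB.instance Definition _ := GRing.Lalgebra_isAlgebra.Build R[i] A cstar_mulZr.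

End cstar_ring.

Section states.
Variables (R : realType) (B : cstarAlgType R).
Implicit Types phi : B -> R[i].

Definition state phi : Prop :=
  [/\ scalar phi, forall b : B, 0 <= phi (star b * b) & phi 1 = 1].

Definition pure_state phi : Prop :=
  state phi /\
  forall (phi1 phi2 : B -> R[i]) (t : R), state phi1 -> state phi2 ->
    0 < t < 1 -> (forall b, phi b = t%:C * phi1 b + (1 - t)%:C * phi2 b) ->
    phi1 = phi /\ phi2 = phi.

End states.

Definition lin_span (K : pzRingType) (V : lmodType K) (S : set V) : set V :=
  [set v | exists n (c : 'I_n -> K) (s : 'I_n -> V),
     (forall i, S (s i)) /\ v = \sum_(i < n) c i *: s i].

(* The inclusion of C(X) in B is a map j, of which only the values on
   continuous functions matter. *)
Section ideals.
Variables (R : realType) (X : topologicalType) (B : cstarAlgType R).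
Variable j : (X -> R[i]) -> B.

Definition JB (x : X) : set B :=
  closure (lin_span [set c | exists (f : X -> R[i]) (b : B),
    [/\ continuous f, f x = 0 & c = j f * b]]).

Definition free_point (x : X) : Prop :=
  exists! phi : B -> R[i], pure_state phi /\
    forall f : X -> R[i], continuous f -> phi (j f) = f x.

Definition opaque_ideal : set B := \bigcap_(x in [set: X]) JB x.

Definition gray_ideal : set B := \bigcap_(x in free_point) JB x.

End ideals.

Section crossed_product.
Variables (R : realType) (G : groupType) (X : topologicalType).
Variable act : G -> X -> X.

Definition homeo_action : Prop :=
  [/\ forall x, act 1%g x = x,
      forall s t x, act (s * t)%g x = act s (act t x)
    & forall s, continuous (act s)].

Definition free_action : Prop := forall s x, s <> 1%g -> act s x <> x.

Definition translate (s : G) (a : X -> R[i]) : X -> R[i] :=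
  fun x => a (act s^-1%g x).

Implicit Types a b : G -> X -> R[i].

(* the underlying set of the *-algebra C_c(G, C(X)), whose linear structure is
   the pointwise one *)
Definition Cc : set (G -> X -> R[i]) :=
  [set a | finite_set [set t | a t <> 0] /\ forall t, continuous (a t)].

(* a sum over [set: G] ranges over the finite support of the summand *)
Definition cc_mul a b : G -> X -> R[i] :=
  fun t => \sum_(s \in [set: G]) a s * translate s (b (s^-1 * t)%g).

Definition cc_star a : G -> X -> R[i] :=
  fun t x => (translate t (a t^-1%g) x)^*.

Definition cc_scale (c : R[i]) a : G -> X -> R[i] := fun t x => c * a t x.

Definition cc_const (f : X -> R[i]) : G -> X -> R[i] :=
  fun t => if t == 1%g then f else 0.

Record cstar_norm (p : (G -> X -> R[i]) -> R[i]) : Prop := CStarNorm {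
  cnorm_ge0 : forall a, Cc a -> 0 <= p a;
  cnorm_eq0 : forall a, Cc a -> p a = 0 -> a = 0;
  cnormD : forall a b, Cc a -> Cc b -> p (a + b) <= p a + p b;
  cnormZ : forall c a, Cc a -> p (cc_scale c a) = `|c| * p a;
  cnormM : forall a b, Cc a -> Cc b -> p (cc_mul a b) <= p a * p b;
  cnormX : forall a, Cc a -> p (cc_mul (cc_star a) a) = p a ^+ 2
}.

(* (B, iota) is the completion of C_c(G, C(X)) in the largest C*-norm; this
   determines it up to a unique isomorphism. *)
Record full_crossed_product (B : cstarAlgType R)
    (iota : (G -> X -> R[i]) -> B) : Prop := FullCrossedProduct {
  fcpD : forall a b, Cc a -> Cc b -> iota (a + b) = iota a + iota b;
  fcpZ : forall c a, Cc a -> iota (cc_scale c a) = c *: iota a;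
  fcpM : forall a b, Cc a -> Cc b -> iota (cc_mul a b) = iota a * iota b;
  fcp_star : forall a, Cc a -> iota (cc_star a) = star (iota a);
  fcp_dense : dense (iota @` Cc);
  fcp_norm : cstar_norm (fun a => `|iota a|);
  fcp_norm_max : forall q, cstar_norm q ->
    forall a, Cc a -> q a <= `|iota a|
}.

End crossed_product.

Definition amenable (R : realType) (G : groupType) : Prop :=
  exists m : (G -> R) -> R,
    [/\ forall f g : G -> R, bounded_fun f -> bounded_fun g ->
          m (f + g) = m f + m g,
        forall (c : R) (f : G -> R), bounded_fun f ->
          m (fun t => c * f t) = c * m f,
        forall f : G -> R, bounded_fun f -> (forall t, 0 <= f t) -> 0 <= m f,
        m (fun=> 1) = 1
      & forall s (f : G -> R), bounded_fun f ->
          m (fun t => f (s^-1 * t)%g) = m f].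

Definition borel (X : ptopologicalType) := g_sigma_algebraType (@open X).

Definition regular_measure (R : realType) (X : ptopologicalType)
    (mu : set (borel X) -> \bar R) : Prop :=
  forall A : set (borel X), measurable A ->
    mu A = ereal_inf [set mu U | U in [set U : set X | open U /\ A `<=` U]] /\
    mu A = ereal_sup [set mu K | K in [set K : set X | compact K /\ K `<=` A]].

Definition invariant_measure (R : realType) (G : groupType)
    (X : ptopologicalType) (act : G -> X -> X)
    (mu : set (borel X) -> \bar R) : Prop :=
  forall s (A : set (borel X)), measurable A -> mu (act s @` A) = mu A.

(* Main.v *)
Require Import Defs.
From HB Require Import structures.
From mathcomp Require Import all_boot all_order all_algebra.
From mathcomp Require Import complex.
From mathcomp Require Import all_classical all_reals all_analysis.
From mathcomp Require Import finmap ring lra.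
Import Order.TTheory GRing.Theory Num.Theory.
Import numFieldNormedType.Exports.
Local Open Scope classical_set_scope.
Local Open Scope complex_scope.
Local Open Scope ring_scope.

(** Every point is free: on Cc(G, C(X)), a state extending the evaluation at x is
    a |-> a(1)(x), since cutting [a] down by a bump function supported close to x
    kills all its other coefficients.  Call phi_x its extension to B.  So the two
    ideals agree, and the same cutting argument shows that b belongs to J_x B as
    soon as phi_x(b . star b) = 0.

    Positive functionals on Cc(G, C(X)) are bounded by the full norm, because
    the maximum of that norm and of a GNS seminorm is again a C*-norm.  This
    applies to omega(a) = sum_t int a(t) dmu, for which omega(u_s) = 1.

    If G is not amenable there are s_1, .., s_n in G and e > 0 such that
    sum_i |s_i xi - xi|^2 >= e |xi|^2 on l^2(G).  The GNS space of phi_x is the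
    l^2-space of the orbit of x, so D = sum_i star(u_(s_i) - 1) . (u_(s_i) - 1)
    is at least e under every phi_x, while omega(D) = 0.  The positive part of
    e - D is then non-zero, because of omega, but invisible to all the phi_x. *)

Set Implicit Arguments.
Unset Strict Implicit.
Unset Printing Implicit Defensive.

(** * The norm of a space over R[i] as a real number *)

(** No spectral theory and no Hilbert space are set up. The one piece of functional calculus is a
    square root of 1 - x, for x self-adjoint of norm at most 1, obtained as the limit of a
    polynomial iteration. GNS spaces appear only through the seminorms |b|^2 = psi (star b . b) on
    the algebra itself, and states on B are extensions of bounded functionals from the dense image
    of Cc.

    This shapes the last step. Put k = l (e - D) with l > 0 a normalization. The bound of D under
    phi_x is available only as phi_x (star c . (D - e) . c) >= 0 for every c. So an element b is
    sought with b . star b = a . k . a and a self-adjoint: phi_x (b . star b) is then both >= 0 and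
    <= 0. The choice a = |k| + k, b = a |k|^(1/2) works because a |k| = a k. The order b . star b is
    the one that fits J_x B, whose functions multiply on the left. The state omega gives |1 + k| >=
    1 + l e > 1, which is what prevents b = 0. *)

Section modulus.
Variable R : realType.
Implicit Types (z w : R[i]) (r : R).

Definition cmod z : R := complex.Re `|z|.

Lemma cmodE z : `|z| = (cmod z)%:C.
Proof. by rewrite /cmod normc_def. Qed.

Lemma cmod_sqr z : cmod z ^+ 2 = complex.Re z ^+ 2 + complex.Im z ^+ 2.
Proof.
by rewrite /cmod normc_def /= sqr_sqrtr // addr_ge0 // sqr_ge0.
Qed.

Lemma cmod_ge0 z : 0 <= cmod z.
Proof. by rewrite -ler0c -cmodE. Qed.

Lemma cmodM z w : cmod (z * w) = cmod z * cmod w.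
Proof. by apply: complexI; rewrite rmorphM -!cmodE normrM. Qed.

Lemma cmodD z w : cmod (z + w) <= cmod z + cmod w.
Proof. by rewrite -lecR rmorphD -!cmodE ler_normD. Qed.

Lemma cmodN z : cmod (- z) = cmod z.
Proof. by rewrite /cmod normrN. Qed.

Lemma cmodR r : cmod r%:C = `|r|.
Proof. by rewrite /cmod normc_def /= expr0n addr0 sqrtr_sqr. Qed.

Lemma cmod1 : cmod 1 = 1.
Proof. by rewrite /cmod normr1. Qed.

Lemma cmod_eq0 z : (cmod z == 0) = (z == 0).
Proof. by rewrite -(normr_eq0 z) cmodE -(inj_eq (@complexI _)). Qed.

Lemma ler_Re_cmod z : complex.Re z <= cmod z.
Proof.
have := normc_ge_Re z; rewrite cmodE lecR; apply: le_trans; exact: ler_norm.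
Qed.

Lemma ler_normRe_cmod z : `|complex.Re z| <= cmod z.
Proof. by have := normc_ge_Re z; rewrite cmodE lecR. Qed.

Lemma ler_normIm_cmod z : `|complex.Im z| <= cmod z.
Proof.
rewrite -(ler_sqr (normr_ge0 _) (cmod_ge0 _)) cmod_sqr -normrX ger0_norm ?sqr_ge0//.
by rewrite lerDr sqr_ge0.
Qed.

Lemma ler_cmod_ReIm z : cmod z <= `|complex.Re z| + `|complex.Im z|.
Proof.
rewrite -(ler_sqr (cmod_ge0 _)) ?nnegrE ?addr_ge0// cmod_sqr sqrrD.
by rewrite !real_normK ?num_real// lerD2r lerDl mulrn_wge0// mulr_ge0.
Qed.

Lemma creD z w : complex.Re (z + w) = complex.Re z + complex.Re w.
Proof. by case: z w => [? ?] []. Qed.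
Lemma cimD z w : complex.Im (z + w) = complex.Im z + complex.Im w.
Proof. by case: z w => [? ?] []. Qed.
Lemma creN z : complex.Re (- z) = - complex.Re z.
Proof. by case: z. Qed.
Lemma cimN z : complex.Im (- z) = - complex.Im z.
Proof. by case: z. Qed.
Lemma creM z w : complex.Re (z * w) =
  complex.Re z * complex.Re w - complex.Im z * complex.Im w.
Proof. by case: z w => [? ?] []. Qed.
Lemma cimM z w : complex.Im (z * w) =
  complex.Re z * complex.Im w + complex.Im z * complex.Re w.
Proof. by case: z w => [? ?] []. Qed.
Lemma creJ z : complex.Re z^* = complex.Re z.
Proof. by case: z. Qed.
Lemma cimJ z : complex.Im z^* = - complex.Im z.
Proof. by case: z. Qed.
Lemma creRM r z : complex.Re (r%:C * z) = r * complex.Re z.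
Proof. by rewrite creM /= mul0r subr0. Qed.
Lemma cimRM r z : complex.Im (r%:C * z) = r * complex.Im z.
Proof. by rewrite cimM /= mul0r addr0. Qed.

Lemma complexP z w :
  complex.Re z = complex.Re w -> complex.Im z = complex.Im w -> z = w.
Proof. by case: z w => [? ?] [? ?] /= -> ->. Qed.

Lemma mulJc z : z^* * z = (cmod z ^+ 2)%:C.
Proof.
rewrite cmod_sqr; apply: complexP; rewrite ?creM ?cimM creJ cimJ /=; ring.
Qed.

Lemma ge0cP z : reflect (complex.Im z = 0 /\ 0 <= complex.Re z) (0 <= z).
Proof. by rewrite lecE /=; apply: (iffP andP) => -[] => [/eqP|->]. Qed.

Lemma ge0cE z : 0 <= z -> z = (complex.Re z)%:C.
Proof. by case: z => a b /ge0cP[/= -> _]. Qed.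

Lemma gt0cE z : 0 < z -> z = (complex.Re z)%:C /\ 0 < complex.Re z.
Proof.
by move=> z0; have e := ge0cE (ltW z0); split=> //; rewrite -ltcR -e.
Qed.

End modulus.

Section real_norm.
Variables (R : realType) (V : normedModType R[i]).
Implicit Types (a b v : V) (r : R).

Definition nrm v : R := complex.Re `|v|.

Lemma nrmE v : `|v| = (nrm v)%:C.
Proof. exact: ge0cE. Qed.

Lemma nrm_ge0 v : 0 <= nrm v.
Proof. by rewrite -ler0c -nrmE. Qed.

Lemma nrmD a b : nrm (a + b) <= nrm a + nrm b.
Proof. by have := ler_normD a b; rewrite !nrmE -rmorphD lecR. Qed.

Lemma nrmN a : nrm (- a) = nrm a.
Proof. by rewrite /nrm normrN. Qed.

Lemma nrmB a b : nrm (a - b) = nrm (b - a).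
Proof. by rewrite /nrm distrC. Qed.

Lemma nrm_dist a b c : nrm (a - b) <= nrm (a - c) + nrm (c - b).
Proof. by have := ler_distD c a b; rewrite !nrmE -rmorphD lecR. Qed.

Lemma nrmZ (c : R[i]) v : nrm (c *: v) = cmod c * nrm v.
Proof. by have := normrZ c v; rewrite cmodE !nrmE -rmorphM => /complexI. Qed.

Lemma nrm0 : nrm (0 : V) = 0.
Proof. by rewrite /nrm normr0. Qed.

Lemma nrm_eq0 v : (nrm v == 0) = (v == 0).
Proof. by rewrite -(normr_eq0 v) nrmE -(inj_eq (@complexI _)). Qed.

Lemma nrm_small v : (forall e : R, 0 < e -> nrm v <= e) -> v = 0.
Proof.
move=> h; apply/eqP; rewrite -nrm_eq0 eq_le nrm_ge0 andbT.
by apply/ler_addgt0Pr => e e0; rewrite add0r h.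
Qed.

Lemma closure_nrmP (A : set V) v :
  closure A v <-> forall e : R, 0 < e -> exists2 a, A a & nrm (v - a) < e.
Proof.
split.
  move=> cl e e0.
  have /cl[a [Aa]] : nbhs v (ball v e%:C).
    by apply: nbhsx_ballx; rewrite ltcR.
  by rewrite -ball_normE /= nrmE ltcR; exists a.
move=> h U /nbhs_ballP[e /= /gt0cE[eE e0] eU].
have [a Aa va] := h _ e0; exists a; split=> //; apply: eU.
by rewrite -ball_normE /= eE nrmE ltcR.
Qed.

Lemma dense_nrmP (A : set V) : dense A ->
  forall v (e : R), 0 < e -> exists2 a, A a & nrm (v - a) < e.
Proof.
move=> dA v e e0.
have [||a [/interior_subset va Aa]] := dA (ball v e%:C)^°.
- by exists v; apply: nbhsx_ballx; rewrite ltcR.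
- exact: open_interior.
by move: va; rewrite -ball_normE /= nrmE ltcR; exists a.
Qed.

End real_norm.

Lemma nrm_complete (R : realType) (V : completeNormedModType R[i])
    (u : nat -> V) :
  (forall e : R, 0 < e -> exists N, forall m n, (N <= n <= m)%N ->
     nrm (u m - u n) < e) ->
  exists l, forall e : R, 0 < e -> exists N, forall n, (N <= n)%N ->
     nrm (l - u n) < e.
Proof.
move=> uC; have : cauchy (u @ \oo).
  apply/cauchy_ballP => e /gt0cE[eE /uC[N uN]].
  pose A := u @` [set n | (N <= n)%N].
  exists (A, A); first by split; exists N => // n Nn; exists n.
  move=> [_ _] /= [[m Nm <-] [n Nn <-]]; rewrite -ball_normE /= eE nrmE ltcR.
  by case/orP: (leq_total m n) => mn; [rewrite nrmB|]; apply: uN; apply/andP.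
move/cauchy_cvgP => cu; exists (lim (u @ \oo)) => e e0.
have : 0 < e%:C by rewrite ltcR.
move/cvgrPdist_lt : cu => /[apply] -[N _ uN].
by exists N => n /uN; rewrite nrmE ltcR.
Qed.

(** * Continuity of complex functions through their real and imaginary parts *)

Section continuous_complex.
Variables (R : realType) (X : topologicalType).
Implicit Types f g : X -> R[i].

Lemma continuousReIm f : continuous f <->
  continuous (fun x => complex.Re (f x)) /\
  continuous (fun x => complex.Im (f x)).
Proof.
split=> [cf|[cr ci]] .
  split=> x; apply/cvgrPdist_lt => e e0; have : 0 < e%:C by rewrite ltcR.
    move/cvgrPdist_lt : (cf x) => /[apply]; apply: filterS => y.
    rewrite cmodE ltcR; apply: le_lt_trans.
    by rewrite -creN -creD ler_normRe_cmod.
  move/cvgrPdist_lt : (cf x) => /[apply]; apply: filterS => y.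
  rewrite cmodE ltcR; apply: le_lt_trans.
  by rewrite -cimN -cimD ler_normIm_cmod.
move=> x; apply/cvgrPdist_lt => e /gt0cE[-> e0].
have e20 : 0 < complex.Re e / 2 by rewrite divr_gt0.
near=> y; rewrite cmodE ltcR (le_lt_trans (ler_cmod_ReIm _))//.
rewrite creD cimD creN cimN (splitr (complex.Re e)) ltrD//; near: y.
- by move/cvgrPdist_lt : (cr x); apply.
- by move/cvgrPdist_lt : (ci x); apply.
Unshelve. all: by end_near. Qed.

Lemma continuous_real (h : X -> R) :
  continuous h -> continuous (fun x => (h x)%:C).
Proof. by move=> ch; apply/continuousReIm; split=> //= x; exact: cvg_cst. Qed.

Lemma continuous_cmul f g : continuous f -> continuous g -> continuous (f * g).
Proof.
move=> /continuousReIm[fr fi] /continuousReIm[gr gi]; apply/continuousReIm.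
split=> x.
  under eq_fun do rewrite creM; apply: cvgB; apply: cvgM;
  [exact: fr|exact: gr|exact: fi|exact: gi].
under eq_fun do rewrite cimM; apply: cvgD; apply: cvgM;
[exact: fr|exact: gi|exact: fi|exact: gr].
Qed.

Lemma continuous_cadd f g : continuous f -> continuous g -> continuous (f + g).
Proof.
move=> /continuousReIm[fr fi] /continuousReIm[gr gi]; apply/continuousReIm.
split=> x.
  by under eq_fun do rewrite creD; apply: cvgD; [exact: fr|exact: gr].
by under eq_fun do rewrite cimD; apply: cvgD; [exact: fi|exact: gi].
Qed.

Lemma continuous_conj f : continuous f -> continuous (fun x => (f x)^*).
Proof.
move=> /continuousReIm[fr fi]; apply/continuousReIm; split=> x.
  by under eq_fun do rewrite creJ; exact: fr.
by under eq_fun do rewrite cimJ; apply: cvgN; exact: fi.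
Qed.

Lemma continuous_ccst (c : R[i]) : continuous (fun _ : X => c).
Proof. by move=> x; exact: cvg_cst. Qed.

Lemma continuous_cmod f : continuous f -> continuous (fun x => cmod (f x)).
Proof.
move=> cf x; apply/cvgrPdist_lt => e e0; have : 0 < e%:C by rewrite ltcR.
move/cvgrPdist_lt : (cf x) => /[apply]; apply: filterS => y.
rewrite cmodE ltcR; apply: le_lt_trans.
have h (a b : R[i]) : cmod a - cmod b <= cmod (a - b).
  by rewrite lerBlDr -{1}(subrK b a) cmodD.
by rewrite ler_norml h andbT lerNl opprB -(cmodN (f x - f y)) opprB h.
Qed.

End continuous_complex.

(** * Square roots in a C*-algebra *)

Section cstar_basics.
Variables (R : realType) (B : cstarAlgType R).
Implicit Types (a b x y z : B).

Lemma starMr a b : star (a * b) = star b * star a.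
Proof. exact: starM. Qed.

Lemma star0 : star (0 : B) = 0.
Proof. by have := starZ 0 (0 : B); rewrite scale0r rmorph0 scale0r. Qed.

Lemma starN a : star (- a) = - star a.
Proof. by rewrite -scaleN1r starZ rmorphN rmorph1 scaleN1r. Qed.

Lemma starB a b : star (a - b) = star a - star b.
Proof. by rewrite starD starN. Qed.

Lemma star1 : star (1 : B) = 1.
Proof. by have := starMr (star (1 : B)) 1; rewrite mulr1 starK mulr1. Qed.

Lemma starZr (r : R) a : star (r%:C *: a) = r%:C *: star a.
Proof. by rewrite starZ; congr (_ *: _); exact: conjc_real. Qed.

Lemma nrmM a b : nrm (a * b) <= nrm a * nrm b.
Proof. by have := cstar_normM a b; rewrite !nrmE -rmorphM lecR. Qed.

Lemma nrmX a : nrm (star a * a) = nrm a ^+ 2.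
Proof. by have := cstar_normX a; rewrite !nrmE -rmorphXn => /complexI. Qed.

Lemma nrm_star a : nrm (star a) = nrm a.
Proof.
suff h b : nrm b <= nrm (star b).
  by apply/eqP; rewrite eq_le {1}h andbT -{2}(starK a) h.
have [->|b0] := eqVneq b 0; first by rewrite star0.
have : 0 < nrm b by rewrite lt_neqAle nrm_ge0 andbT eq_sym nrm_eq0.
by move=> b1; rewrite -(ler_pM2r b1) -expr2 -nrmX nrmM.
Qed.

Lemma nrmXr a : nrm (a * star a) = nrm a ^+ 2.
Proof. by rewrite -{1}(starK a) nrmX nrm_star. Qed.

Lemma nrm1 : nrm (1 : B) = 1.
Proof.
have := nrmX (1 : B); rewrite star1 mul1r expr2.
have : nrm (1 : B) != 0 by rewrite nrm_eq0 oner_eq0.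
by move=> n0; rewrite -[LHS]mulr1 => /(mulfI n0).
Qed.

Lemma nrmZr (r : R) a : nrm (r%:C *: a) = `|r| * nrm a.
Proof. by rewrite nrmZ cmodR. Qed.

Lemma nrm_sa_sqr a : star a = a -> nrm (a * a) = nrm a ^+ 2.
Proof. by move=> {1}<-; rewrite nrmX. Qed.

(** The fixed points of y |-> (x + y y) / 2 are the y with (1 - y)^2 = 1 - x, so the limit plays the
    role of 1 - sqrt (1 - x). The iterates are polynomials in x with nonnegative coefficients: they
    inherit self-adjointness and commutation from x, and the same iteration at the number 1
    dominates them. *)
Fixpoint sqrt_iter x n : B :=
  if n is n'.+1 then (2^-1)%:C *: (x + sqrt_iter x n' * sqrt_iter x n') else 0.

(* majorizes the norms of [sqrt_iter x n] and of their increments when x has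
   norm at most 1 *)
Fixpoint sqrt_maj n : R :=
  if n is n'.+1 then 2^-1 * (1 + sqrt_maj n' ^+ 2) else 0.

Lemma sqrt_maj_itv n : 0 <= sqrt_maj n <= 1.
Proof.
elim: n => [|n /andP[h0 h1]] /=; first by rewrite lexx ler01.
have := exprn_ile1 2 h0 h1; have := sqr_ge0 (sqrt_maj n).
move: (_ ^+ 2) => t t0 t1; rewrite mulr_ge0 ?addr_ge0 ?invr_ge0//=.
by rewrite ler_pdivrMl// mulr1; move: t0 t1; lra.
Qed.

(** With t = 1 - s the scalar iteration is t |-> t - t^2 / 2, which decays like 2 / n: the fixed
    point is neutral and no geometric rate is available. For s = 1 - 2 / m the two sides differ by
    exactly 2 / (m^2 (m + 1)). *)
Lemma sqrt_maj_step (s m : R) : 2 <= m -> 1 - 2 / m <= s ->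
  1 - 2 / (m + 1) <= 2^-1 * (1 + s ^+ 2).
Proof.
move=> m2 ms; have m0 : 0 < m by lra.
have t1 : 2 / m <= 1 by rewrite ler_pdivrMr// mul1r.
have : (1 - 2 / m) ^+ 2 <= s ^+ 2.
  by move: (2 / m) t1 ms => t ? ?; apply: lerXn2r; rewrite ?nnegrE; lra.
suff : 0 <= 2^-1 * (1 + (1 - 2 / m) ^+ 2) - (1 - 2 / (m + 1)).
  move: ((1 - 2 / m) ^+ 2) (2 / (m + 1)) (s ^+ 2) => ? ? ?; lra.
have -> : 2^-1 * (1 + (1 - 2 / m) ^+ 2) - (1 - 2 / (m + 1)) =
   2 / (m ^+ 2 * (m + 1)) by field; apply/andP; split; apply: lt0r_neq0; lra.
by rewrite divr_ge0// mulr_ge0 ?sqr_ge0//; lra.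
Qed.

(** The offset 2 makes the bound equal to the initial value 0 at n = 0 and keeps m >= 2 in
    [sqrt_maj_step]. *)
Lemma sqrt_maj_ge n : 1 - 2 / n.+2%:R <= sqrt_maj n.
Proof.
elim: n => [|n IH] /=; first by rewrite divff// subrr.
by rewrite -[n.+3%:R]natr1; apply: sqrt_maj_step; rewrite ?ler_nat.
Qed.

Lemma sqrt_iter_le x n : nrm x <= 1 -> nrm (sqrt_iter x n) <= sqrt_maj n.
Proof.
move=> x1; elim: n => [|n IH] /=; first by rewrite nrm0.
rewrite nrmZr ger0_norm ?invr_ge0// ler_pM2l ?invr_gt0//.
rewrite (le_trans (nrmD _ _))// lerD// (le_trans (nrmM _ _))// expr2.
by rewrite ler_pM ?nrm_ge0.
Qed.

(** If p and q majorize u and v, and p - q majorizes u - v, then u u - v v = u (u - v) + (u - v) v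
    has norm at most (p + q) (p - q) = p^2 - q^2, which is the next increment of the scalar
    iteration up to the factor 1/2. *)
Lemma sqrt_iter_dist x n k : nrm x <= 1 ->
  nrm (sqrt_iter x (n + k) - sqrt_iter x n) <= sqrt_maj (n + k) - sqrt_maj n.
Proof.
move=> x1; elim: n => [|n IH].
  by rewrite add0n !subr0 sqrt_iter_le.
rewrite addSn /=; move: (n + k)%N IH (sqrt_iter_le (n + k) x1) => m IH hm.
rewrite -scalerBr nrmZr ger0_norm ?invr_ge0// -mulrBr ler_pM2l ?invr_gt0//.
rewrite !opprD !addrA [x + _ - x]addrAC subrr add0r.
set u := sqrt_iter x m in IH hm *; set v := sqrt_iter x n in IH *.
have -> : u * u - v * v = u * (u - v) + (u - v) * v.
  by rewrite mulrBr mulrBl addrA subrK.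
have hv : nrm v <= sqrt_maj n by exact: sqrt_iter_le.
apply: le_trans (nrmD _ _) _.
have h1 : nrm (u * (u - v)) <= sqrt_maj m * (sqrt_maj m - sqrt_maj n).
  by rewrite (le_trans (nrmM _ _))// ler_pM ?nrm_ge0.
have h2 : nrm ((u - v) * v) <= (sqrt_maj m - sqrt_maj n) * sqrt_maj n.
  by rewrite (le_trans (nrmM _ _))// ler_pM ?nrm_ge0.
by apply: le_trans (lerD h1 h2) _; rewrite le_eqVlt; apply/orP; left; apply/eqP; ring.
Qed.

Lemma nrm_mul_close a b a' b' (e : R) : nrm a <= 1 -> nrm b' <= 1 ->
  nrm (a - a') <= e -> nrm (b - b') <= e -> nrm (a * b - a' * b') <= 2 * e.
Proof.
move=> a1 b1 ha hb.
have -> : a * b - a' * b' = a * (b - b') + (a - a') * b'.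
  by rewrite mulrBr mulrBl addrA subrK.
have -> : 2 * e = 1 * e + e * 1 by ring.
apply: le_trans (nrmD _ _) _; apply: lerD; apply: le_trans (nrmM _ _) _;
  by rewrite ler_pM ?nrm_ge0.
Qed.

(** Positivity of 1 - x is encoded by the norm of x, as no spectrum is at hand. The bound on y
    allows a second application, to y itself, and the commutation clause makes the roots compatible
    with the elements they come from. *)
Lemma cstar_sqrt x : star x = x -> nrm x <= 1 ->
  exists y, [/\ star y = y, nrm y <= 1, (1 - y) * (1 - y) = 1 - x &
                forall z, z * x = x * z -> z * y = y * z].
Proof.
move=> xs x1.
have small (e : R) : 0 < e -> exists N, 2 / N.+2%:R < e.
  move=> e0; have [N hN] : exists N, 2 / e < N%:R.
    by exists (Num.truncn (2 / e)).+1; rewrite truncnS_gt.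
  exists N; rewrite ltr_pdivrMr// mulrC -ltr_pdivrMr//.
  by apply: lt_le_trans hN _; rewrite ler_nat -addn2 leq_addr.
have dist m n : (n <= m)%N ->
    nrm (sqrt_iter x m - sqrt_iter x n) <= 2 / n.+2%:R.
  move=> nm; rewrite -(subnKC nm); apply: le_trans (sqrt_iter_dist _ _ x1) _.
  have /andP[_ h] := sqrt_maj_itv (n + (m - n)).
  by apply: le_trans (lerB h (sqrt_maj_ge n)) _; rewrite opprB addrCA subrr addr0.
have [y hy] : exists y, forall e : R, 0 < e -> exists N, forall n, (N <= n)%N ->
     nrm (y - sqrt_iter x n) < e.
  apply: nrm_complete => e /small[N hN]; exists N => m n /andP[Nn nm].
  apply: le_lt_trans hN; apply: le_trans (dist _ _ nm) _.
  by rewrite ler_pM2l// lef_pV2 ?posrE// ler_nat.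
have u1 n : nrm (sqrt_iter x n) <= 1.
  apply: le_trans (sqrt_iter_le n x1) _; by case/andP: (sqrt_maj_itv n).
have y1 : nrm y <= 1.
  apply/ler_addgt0Pr => e e0; have [N /(_ N (leqnn _)) h] := hy e e0.
  rewrite -(subrK (sqrt_iter x N) y) (le_trans (nrmD _ _))// addrC lerD//.
  exact: ltW.
have us n : star (sqrt_iter x n) = sqrt_iter x n.
  by elim: n => [|n IH] /=; rewrite ?star0// starZr starD xs starMr IH.
have uc z n : z * x = x * z -> z * sqrt_iter x n = sqrt_iter x n * z.
  move=> zx; elim: n => [|n IH] /=; first by rewrite mulr0 mul0r.
  rewrite -scalerAr -scalerAl; congr (_ *: _).
  by rewrite mulrDr mulrDl zx mulrA IH -!mulrA IH.
exists y; split=> //.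
- apply/eqP; rewrite -subr_eq0; apply/eqP/nrm_small => e e0.
  have [N /(_ N (leqnn _)) h] := hy (e / 2) (divr_gt0 e0 (ltr0n _ 2)).
  rewrite (le_trans (nrm_dist _ _ (sqrt_iter x N)))// -{1}us -starB nrm_star.
  by rewrite -nrmB in h *; rewrite (splitr e) lerD// ltW// nrmB.
- apply/eqP; rewrite -subr_eq0; apply/eqP/nrm_small => e e0.
  have e40 : 0 < e / 4 by rewrite divr_gt0.
  have [N hN] := hy _ e40.
  have hu := hN _ (leqnn N); have hv := hN _ (leqnSn N).
  set u := sqrt_iter x N in hu.
  have e2 : x + u * u = 2%:R *: sqrt_iter x N.+1.
    rewrite /= scalerA -/u; set c := (X in X *: _).
    have -> : c = 1 by rewrite /c rmorphV ?unitfE//= rmorph_nat divff.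
    by rewrite scale1r.
  (* By the recursion x = 2 u' - u u with u' the iterate after u; this leaves two differences, each
     at most 2 (e / 4). *)
  have -> : (1 - y) * (1 - y) - (1 - x) =
      (y * y - u * u) - 2%:R *: (y - sqrt_iter x N.+1).
    rewrite scalerBr -e2 mulrBl mul1r mulrBr mulr1.
    rewrite scaler_nat mulr2n !opprB !opprD !addrA.
    rewrite [LHS](ACl (1*6*4*2*3*5)) [RHS](ACl (2*4*1*5*6*3)) /=.
    by rewrite subrr addNr !add0r [LHS](ACl (3*1*2*4)).
  apply: le_trans (nrmD _ _) _; rewrite nrmN.
  have -> : e = 2 * (e / 4) + 2 * (e / 4) by field.
  apply: lerD.
    by apply: nrm_mul_close => //; [exact: u1|exact: ltW|exact: ltW].
  have -> : (2%:R : R[i]) = (2 : R)%:C by rewrite rmorph_nat.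
  by rewrite nrmZr ger0_norm// ler_pM2l// ltW.
- move=> z zx; apply/eqP; rewrite -subr_eq0; apply/eqP/nrm_small => e e0.
  set K := 2 * nrm z + 1.
  have K0 : 0 < K by rewrite ltr_wpDl// mulr_ge0// nrm_ge0.
  have [N /(_ N (leqnn _)) h] := hy (e / K) (divr_gt0 e0 K0).
  have -> : z * y - y * z = z * (y - sqrt_iter x N) - (y - sqrt_iter x N) * z.
    by rewrite mulrBr mulrBl (uc z N zx) opprB addrA subrK.
  apply: le_trans (nrmD _ _) _; rewrite nrmN.
  apply: (@le_trans _ _ (nrm z * (e / K) + (e / K) * nrm z)).
    by rewrite lerD// (le_trans (nrmM _ _))// ?ler_wpM2l ?ler_wpM2r ?nrm_ge0 ?(ltW h).
  rewrite mulrC -mulrDr -mulrA ler_piMr ?(ltW e0)// mulrC ler_pdivrMr// /K; lra.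
Qed.

End cstar_basics.

(** * The GNS seminorm of a positive functional *)

Record star_subalgebra (R : realType) (B : cstarAlgType R) (S : set B) : Prop :=
  StarSubalgebra {
  ssub1 : S 1;
  ssubD : forall a b, S a -> S b -> S (a + b);
  ssubZ : forall c a, S a -> S (c *: a);
  ssubM : forall a b, S a -> S b -> S (a * b);
  ssub_star : forall a, S a -> S (star a) }.

Record positive_on (R : realType) (B : cstarAlgType R) (S : set B)
    (psi : B -> R[i]) : Prop := PositiveOn {
  posD : forall a b, S a -> S b -> psi (a + b) = psi a + psi b;
  posZ : forall c a, S a -> psi (c *: a) = c * psi a;
  pos_ge0 : forall b, S b -> 0 <= psi (star b * b) }.

(** The minimum over t is at C^-1. The number Z sits in both t-terms because Cauchy-Schwarz will be
    tested on b - t z^* c with z = psi (star b . c) and Z = |z|^2, the phase of z^* making the cross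
    terms real. *)
Lemma discriminant_le (R : realType) (A C Z : R) : 0 <= Z -> 0 <= C ->
  (forall t, 0 <= A - 2 * t * Z + t ^+ 2 * Z * C) -> Z <= A * C.
Proof.
move=> Z0 C0 h; have A0 : 0 <= A by have := h 0; rewrite !(mulr0, mul0r, expr0n) /= subr0 addr0.
have [->|Zn] := eqVneq Z 0; first by rewrite mulr_ge0.
have Zp : 0 < Z by rewrite lt_neqAle eq_sym Zn.
have [C00|Cn] := eqVneq C 0.
  (* For C = 0 the expression is affine in t, and this t gives it the value -1. *)
  have := h ((A + 1) / (2 * Z)); rewrite C00 mulr0 addr0.
  have -> : A - 2 * ((A + 1) / (2 * Z)) * Z = - 1 by field.
  by rewrite ler0N1.
have Cp : 0 < C by rewrite lt_neqAle eq_sym Cn.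
have := h C^-1.
have -> : A - 2 * C^-1 * Z + C^-1 ^+ 2 * Z * C = A - Z / C by field.
by rewrite subr_ge0 ler_pdivrMr.
Qed.

Section positive_functional.
Variables (R : realType) (B : cstarAlgType R) (S : set B) (psi : B -> R[i]).
Hypotheses (SA : star_subalgebra S) (psiP : positive_on S psi).
Implicit Types (a b c : B).

Let S1 := ssub1 SA.
Let SD := ssubD SA.
Let SZ := ssubZ SA.
Let SM := ssubM SA.
Let Ss := ssub_star SA.

Lemma ssubN a : S a -> S (- a).
Proof. by move=> Sa; rewrite -scaleN1r; exact: SZ. Qed.

Lemma ssubB a b : S a -> S b -> S (a - b).
Proof. by move=> Sa Sb; apply: SD => //; exact: ssubN. Qed.

Lemma posN a : S a -> psi (- a) = - psi a.
Proof. by move=> Sa; rewrite -scaleN1r (posZ psiP)// mulN1r. Qed.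

Lemma posB a b : S a -> S b -> psi (a - b) = psi a - psi b.
Proof. by move=> Sa Sb; rewrite (posD psiP) ?posN//; exact: ssubN. Qed.

(** Hermitian symmetry follows from positivity by polarization: the value of psi at star (a + l) .
    (a + l) is real, and the cross terms for l = 1 and l = i fix the imaginary and the real part. *)
Lemma pos_star a : S a -> psi (star a) = (psi a)^*.
Proof.
move=> Sa.
have h (l : R[i]) : complex.Im (l * psi (star a) + l^* * psi a) = 0.
  have Sl : S (l *: 1) by exact: SZ.
  have := pos_ge0 psiP (SD Sa Sl); rewrite starD starZ star1.
  rewrite mulrDl !mulrDr -!scalerAl -!scalerAr !mul1r mulr1.
  have Sas := Ss Sa.
  rewrite !(posD psiP, posZ psiP) //; do ?[exact: SM|exact: SZ|exact: SD].
    have /ge0cP[i1 _] := pos_ge0 psiP Sa; have := pos_ge0 psiP S1.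
    rewrite star1 mul1r => /ge0cP[i2 _] /ge0cP[+ _].
    by rewrite mulrA [l^* * l]mulJc !cimD i1 cimRM i2 mulr0 addr0 add0r.
    by apply: SD; [exact: SM|exact: SZ].
  by apply: SD; do ?apply: SZ.
have := h 1; have := h 'i%C.
rewrite rmorph1 !mul1r !cimD !cimM creJ cimJ /= !mul0r !mul1r !add0r => h1 h2.
by apply: complexP; rewrite ?creJ ?cimJ; move: h1 h2; lra.
Qed.

(** The squared length of the vector b in the GNS space of [psi]. *)
Definition psi_sqn b : R := complex.Re (psi (star b * b)).

Lemma psi_sqn_ge0 b : S b -> 0 <= psi_sqn b.
Proof. by move=> /(pos_ge0 psiP)/ge0cP[]. Qed.

Lemma psi_sqnE b : S b -> psi (star b * b) = (psi_sqn b)%:C.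
Proof. by move=> /(pos_ge0 psiP)/ge0cE. Qed.

Lemma cauchy_schwarz b c : S b -> S c ->
  cmod (psi (star b * c)) ^+ 2 <= psi_sqn b * psi_sqn c.
Proof.
move=> Sb Sc; apply: discriminant_le; rewrite ?sqr_ge0 ?psi_sqn_ge0// => t.
set z := psi (star b * c).
have zJ : psi (star c * b) = z^* by rewrite -pos_star ?starMr ?starK//; exact: SM (Ss _) _.
set l : R[i] := t%:C * z^*.
have Sl : S (l *: c) by exact: SZ.
have lJ : l^* = t%:C * z.
  by rewrite /l; case: (z) => u v; apply: complexP => /=; ring.
have [Sbs Scs] := (Ss Sb, Ss Sc).
have Sll : S (star c * c) by exact: SM.
have h := psi_sqn_ge0 (ssubB Sb Sl); rewrite /psi_sqn in h.
rewrite starB starZ mulrBl !mulrBr -!scalerAl -!scalerAr in h.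
rewrite !(posB, posZ psiP) in h; do ?[exact: SM|exact: SZ].
  rewrite -/z zJ (psi_sqnE Sb) (psi_sqnE Sc) lJ in h.
  apply: le_trans h _; rewrite le_eqVlt; apply/orP; left; apply/eqP.
  rewrite /l cmod_sqr; move: (psi_sqn b) (psi_sqn c) => A C.
  by case: z {zJ l Sl lJ} => u v /=; ring.
all: by do ?[exact: SM|exact: SZ (SM _ _)|apply: ssubB|apply: SZ].
Qed.

Lemma psi_sqnD b c : S b -> S c ->
  Num.sqrt (psi_sqn (b + c)) <= Num.sqrt (psi_sqn b) + Num.sqrt (psi_sqn c).
Proof.
move=> Sb Sc.
have [b0 c0] := (psi_sqn_ge0 Sb, psi_sqn_ge0 Sc).
have bc0 := psi_sqn_ge0 (SD Sb Sc).
rewrite -ler_sqr ?nnegrE ?addr_ge0 ?sqrtr_ge0//.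
rewrite sqrrD !sqr_sqrtr// {1}/psi_sqn starD mulrDl !mulrDr.
have [Sbs Scs] := (Ss Sb, Ss Sc).
rewrite !(posD psiP); do ?[exact: SM|exact: SD (SM _ _) (SM _ _)].
have -> : psi (star c * b) = (psi (star b * c))^*.
  by rewrite -pos_star ?starMr ?starK//; exact: SM.
rewrite !creD creJ -/(psi_sqn b) -/(psi_sqn c).
have := cauchy_schwarz Sb Sc; set z := psi _ => h.
have : complex.Re z <= Num.sqrt (psi_sqn b) * Num.sqrt (psi_sqn c).
  apply: le_trans (ler_Re_cmod _) _.
  by rewrite -sqrtrM// -[leLHS]ger0_norm ?cmod_ge0// -sqrtr_sqr ler_wsqrtr.
rewrite mulr2n; lra.
Qed.

Hypothesis psi_bounded : forall a, S a ->
  exists2 M, 0 <= M & forall b, S b -> psi_sqn (a * b) <= M * psi_sqn b.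

(** The squared operator norm of left multiplication by a on the GNS space. Since [S] need not be
    complete, positivity alone does not bound this operator; without [psi_bounded] the set could be
    unbounded and [sup] would take its default value 0. *)
Definition gns_sqn a : R :=
  sup [set psi_sqn (a * b) | b in [set b | S b /\ psi_sqn b <= 1]].

Definition gns_norm a : R := Num.sqrt (gns_sqn a).

Lemma psi_sqnZ (k : R[i]) b : S b -> psi_sqn (k *: b) = cmod k ^+ 2 * psi_sqn b.
Proof.
move=> Sb; rewrite /psi_sqn starZ -scalerAl -scalerAr scalerA (posZ psiP).
  by rewrite mulJc creRM.
by apply: SM => //; apply: Ss.
Qed.

Lemma psi_sqn0 : psi_sqn 0 = 0.
Proof. by rewrite -(scale0r (1 : B)) psi_sqnZ// cmodR normr0 expr0n mul0r. Qed.

Lemma gns_sqn_ge0 a : S a -> 0 <= gns_sqn a.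
Proof.
move=> Sa; have [M M0 aM] := psi_bounded Sa.
apply: ub_le_sup; first exists M.
  move=> _ [b [Sb b1] <-]; apply: le_trans (aM _ Sb) _.
  by rewrite ler_piMr.
exists 0; last by rewrite mulr0 psi_sqn0.
by split; [rewrite -(scale0r (1 : B)); exact: SZ|rewrite psi_sqn0].
Qed.

Lemma psi_sqn_gns a b : S a -> S b -> psi_sqn (a * b) <= gns_sqn a * psi_sqn b.
Proof.
move=> Sa Sb; have [M M0 aM] := psi_bounded Sa.
(* A vector of length 0 cannot be normalized; [psi_bounded] shows that its image also has length
   0. *)
have := psi_sqn_ge0 Sb; rewrite le_eqVlt => /orP[/eqP b0|b0].
  by have := aM _ Sb; rewrite -b0 !mulr0.
pose r := Num.sqrt (psi_sqn b).
have r0 : 0 < r by rewrite sqrtr_gt0.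
have rE : r ^+ 2 = psi_sqn b by rewrite sqr_sqrtr// ltW.
rewrite -rE -ler_pdivrMr ?exprn_gt0//.
apply: ub_le_sup; first exists M.
  move=> _ [c [Sc c1] <-]; apply: le_trans (aM _ Sc) _.
  by rewrite ler_piMr.
exists ((r^-1)%:C *: b); last first.
  rewrite -scalerAr psi_sqnZ; last exact: SM.
  by rewrite cmodR ger0_norm ?invr_ge0 ?(ltW r0)// exprVn mulrC.
split; first exact: SZ.
rewrite psi_sqnZ// cmodR ger0_norm ?invr_ge0 ?(ltW r0)// exprVn rE.
by rewrite mulVf// gt_eqF.
Qed.

Lemma gns_sqn_le a M : 0 <= M ->
  (forall b, S b -> psi_sqn (a * b) <= M * psi_sqn b) -> gns_sqn a <= M.
Proof.
move=> M0 h; apply: ge_sup.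
  exists (psi_sqn (a * 0)); exists 0 => //.
  by split; [rewrite -(scale0r (1 : B)); exact: SZ|rewrite psi_sqn0].
by move=> _ [c [Sc c1] <-]; apply: le_trans (h _ Sc) _; rewrite ler_piMr.
Qed.

Lemma gns_norm_ge0 a : 0 <= gns_norm a.
Proof. exact: sqrtr_ge0. Qed.

Lemma gns_norm_sqr a : S a -> gns_norm a ^+ 2 = gns_sqn a.
Proof. by move=> Sa; rewrite sqr_sqrtr// gns_sqn_ge0. Qed.

Lemma gns_norm_le a M : S a -> 0 <= M ->
  (forall b, S b -> psi_sqn (a * b) <= M ^+ 2 * psi_sqn b) -> gns_norm a <= M.
Proof.
move=> Sa M0 h; rewrite -ler_sqr ?nnegrE ?gns_norm_ge0// gns_norm_sqr//.
by apply: gns_sqn_le; rewrite ?sqr_ge0.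
Qed.

Lemma psi_sqn_gns_norm a b : S a -> S b ->
  Num.sqrt (psi_sqn (a * b)) <= gns_norm a * Num.sqrt (psi_sqn b).
Proof.
by move=> Sa Sb; rewrite -sqrtrM ?gns_sqn_ge0// ler_wsqrtr// psi_sqn_gns.
Qed.

Lemma gns_normD a b : S a -> S b -> gns_norm (a + b) <= gns_norm a + gns_norm b.
Proof.
move=> Sa Sb; apply: gns_norm_le; rewrite ?addr_ge0 ?gns_norm_ge0//.
  exact: SD.
move=> c Sc; rewrite mulrDl.
have h : Num.sqrt (psi_sqn (a * c + b * c)) <=
    (gns_norm a + gns_norm b) * Num.sqrt (psi_sqn c).
  apply: le_trans (psi_sqnD (SM Sa Sc) (SM Sb Sc)) _.
  by rewrite mulrDl lerD// psi_sqn_gns_norm.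
have c0 := psi_sqn_ge0 Sc.
have n0 : 0 <= psi_sqn (a * c + b * c) by apply/psi_sqn_ge0/SD; exact: SM.
rewrite -(sqr_sqrtr n0) -(sqr_sqrtr c0) -exprMn.
by rewrite ler_sqr ?nnegrE ?sqrtr_ge0// mulr_ge0 ?addr_ge0 ?sqrtr_ge0.
Qed.

Lemma gns_normM a b : S a -> S b -> gns_norm (a * b) <= gns_norm a * gns_norm b.
Proof.
move=> Sa Sb; apply: gns_norm_le; rewrite ?mulr_ge0 ?gns_norm_ge0//.
  exact: SM.
move=> c Sc; rewrite -mulrA exprMn !gns_norm_sqr//.
apply: le_trans (psi_sqn_gns Sa (SM Sb Sc)) _.
by rewrite -mulrA ler_wpM2l ?gns_sqn_ge0// psi_sqn_gns.
Qed.

Lemma gns_normZ (c : R[i]) a : S a -> gns_norm (c *: a) = cmod c * gns_norm a.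
Proof.
have le (d : R[i]) b : S b -> gns_norm (d *: b) <= cmod d * gns_norm b.
  move=> Sb; apply: gns_norm_le; first exact: SZ.
    by rewrite mulr_ge0 ?cmod_ge0 ?gns_norm_ge0.
  move=> e Se; rewrite -scalerAl psi_sqnZ; last exact: SM.
  rewrite exprMn gns_norm_sqr // -[leRHS]mulrA ler_wpM2l ?sqr_ge0 //.
  exact: psi_sqn_gns.
move=> Sa; have [->|c0] := eqVneq c 0.
  apply/eqP; rewrite eq_le le//= /cmod normr0 mul0r; exact: gns_norm_ge0.
apply/eqP; rewrite eq_le le//=.
have := le c^-1 _ (SZ c Sa); rewrite scalerA mulVf// scale1r => h.
have m0 : 0 < cmod c by rewrite lt_neqAle eq_sym cmod_eq0 c0 cmod_ge0.
rewrite -ler_pdivlMl//; apply: le_trans h _.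
suff -> : cmod c^-1 = (cmod c)^-1 by [].
by apply/(mulfI (lt0r_neq0 m0)); rewrite -cmodM !divff ?cmod1// gt_eqF.
Qed.

(** The square of |b c| is psi (star c . (star b . b . c)), so Cauchy-Schwarz gives |b|^2 <= |star b
    . b|. With submultiplicativity this yields |b| <= |star b|, hence equality for the adjoint and
    the reverse inequality. *)
Lemma gns_normX a : S a -> gns_norm (star a * a) = gns_norm a ^+ 2.
Proof.
have X b : S b -> gns_norm b ^+ 2 <= gns_norm (star b * b).
  move=> Sb; have Sbb : S (star b * b) by exact: SM (Ss _) _.
  rewrite gns_norm_sqr//; apply: gns_sqn_le; first exact: gns_norm_ge0.
  move=> c Sc; have Sbc : S (b * c) by exact: SM.
  rewrite {1}/psi_sqn starMr -mulrA [star b * _]mulrA.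
  apply: le_trans (ler_Re_cmod _) _.
  have Sx : S ((star b * b) * c) by exact: SM.
  have := cauchy_schwarz Sc Sx; have c0 := psi_sqn_ge0 Sc.
  have n0 := gns_norm_ge0 (star b * b).
  have := psi_sqn_gns Sbb Sc; rewrite -gns_norm_sqr// => h1 h2.
  rewrite -ler_sqr ?nnegrE ?cmod_ge0 ?mulr_ge0//; apply: le_trans h2 _.
  by rewrite exprMn [psi_sqn c ^+ 2]expr2 mulrCA ler_wpM2l.
have L b : S b -> gns_norm b <= gns_norm (star b).
  move=> Sb; have := gns_norm_ge0 b; rewrite le_eqVlt => /orP[/eqP<-|b0].
    exact: gns_norm_ge0.
  rewrite -(ler_pM2r b0) -expr2; apply: le_trans (X _ Sb) _.
  exact: gns_normM (Ss _) _.
move=> Sa; apply/eqP; rewrite eq_le X// andbT.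
apply: le_trans (gns_normM (Ss Sa) Sa) _; rewrite expr2.
rewrite ler_wpM2r ?gns_norm_ge0//.
by have := L _ (Ss Sa); rewrite starK.
Qed.

Lemma psi_le_gns a : psi 1 = 1 -> S a -> cmod (psi a) <= gns_norm a.
Proof.
move=> p1 Sa; have := cauchy_schwarz S1 Sa; rewrite star1 mul1r => h.
have n1 : psi_sqn 1 = 1 by rewrite /psi_sqn star1 mul1r p1.
rewrite -ler_sqr ?nnegrE ?cmod_ge0 ?gns_norm_ge0// gns_norm_sqr//.
apply: le_trans h _; rewrite n1 mul1r.
by have := psi_sqn_gns Sa S1; rewrite mulr1 n1 mulr1.
Qed.

End positive_functional.

(** * The *-algebra Cc(G, C(X)) *)

Section crossed_algebra.
Variables (R : realType) (G : groupType) (X : topologicalType).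
Variable act : G -> X -> X.
Hypothesis actP : homeo_action act.
Implicit Types (a b c : G -> X -> R[i]) (f g h : X -> R[i]) (s t : G).

Let act1 : forall x, act 1%g x = x. Proof. by case: actP. Qed.
Let act_cont s : continuous (act s). Proof. by case: actP. Qed.

(** The monomial usually written f u_s; these span Cc(G, C(X)). *)
Definition mon f s : G -> X -> R[i] := fun t => if t == s then f else 0.

Lemma translate1 f : translate act 1%g f = f.
Proof. by apply/funext => x; rewrite /translate invg1 act1. Qed.

Lemma translate_cont s f : continuous f -> continuous (translate act s f).
Proof. by move=> cf x; apply: continuous_comp; [exact: act_cont|exact: cf]. Qed.

Lemma Cc_cont a t : Cc a -> continuous (a t).
Proof. by case. Qed.

Lemma Cc_fset a : Cc a -> exists D : {fset G}, forall t, t \notin D -> a t = 0.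
Proof.
move=> [fa _]; exists (fset_set [set t | a t <> 0]) => t.
by rewrite in_fset_set// notin_setE /= => /contrapT.
Qed.

Lemma Cc_of_fset a (D : {fset G}) : (forall t, t \notin D -> a t = 0) ->
  (forall t, continuous (a t)) -> Cc a.
Proof.
move=> aD ca; split=> //; apply: (@finite_subfset _ D) => t /= at0.
by apply: contra_notT at0 => /aD.
Qed.

Lemma continuous_c0 : continuous (0 : X -> R[i]).
Proof. exact (@continuous_ccst R X 0). Qed.

Lemma continuous_c1 : continuous (1 : X -> R[i]).
Proof. exact (@continuous_ccst R X 1). Qed.

Lemma continuous_csum (I : Type) (r : seq I) (F : I -> X -> R[i]) :
  (forall i, continuous (F i)) -> continuous (\sum_(i <- r) F i).
Proof.
move=> cF; elim: r => [|i r IH]; first (rewrite big_nil; exact continuous_c0).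
rewrite big_cons; exact: (continuous_cadd (cF i) IH).
Qed.

Lemma Cc0 : Cc (0 : G -> X -> R[i]).
Proof.
by apply: (@Cc_of_fset _ fset0) => [//|t]; exact continuous_c0.
Qed.

Lemma Cc_mon f s : continuous f -> Cc (mon f s).
Proof.
move=> cf; apply: (@Cc_of_fset _ [fset s]%fset) => t.
  by rewrite inE /mon => /negbTE ->.
by rewrite /mon; case: ifP => _; [exact cf|exact continuous_c0].
Qed.

Lemma Cc_add a b : Cc a -> Cc b -> Cc (a + b).
Proof.
move=> Ca Cb; have [Da hA] := Cc_fset Ca; have [Db hB] := Cc_fset Cb.
apply: (@Cc_of_fset _ (Da `|` Db)%fset) => t.
  rewrite inE negb_or => /andP[ta tb].
  by rewrite [LHS]/= -[RHS]addr0 -{1}(hA _ ta) -(hB _ tb).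
exact (continuous_cadd (@Cc_cont _ t Ca) (@Cc_cont _ t Cb)).
Qed.

Lemma Cc_scale (k : R[i]) a : Cc a -> Cc (cc_scale k a).
Proof.
move=> Ca; have [D aD] := Cc_fset Ca; apply: (@Cc_of_fset _ D) => t.
  by move=> /aD at0; apply/funext => x; rewrite /cc_scale at0 mulr0.
exact (continuous_cmul (@continuous_ccst R X k) (@Cc_cont _ t Ca)).
Qed.

Lemma Cc_star a : Cc a -> Cc (cc_star act a).
Proof.
move=> Ca; have [D aD] := Cc_fset Ca.
apply: (@Cc_of_fset _ [fset t^-1%g | t in D]%fset) => t.
  move=> tD; have /aD at0 : t^-1%g \notin D.
    apply: contra tD => tD; apply/imfsetP; exists t^-1%g => //=.
    by rewrite invgK.
  by apply/funext => x; rewrite /cc_star /translate at0 conjC0.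
exact (continuous_conj (translate_cont (s:=t) (@Cc_cont _ t^-1%g Ca))).
Qed.

Lemma cc_mulE a b (D : {fset G}) t : (forall s, s \notin D -> a s = 0) ->
  cc_mul act a b t = \sum_(s <- D) a s * translate act s (b (s^-1 * t)%g).
Proof.
move=> aD; rewrite /cc_mul (fsbigTE D)// => s /aD ->.
by rewrite mul0r.
Qed.

Lemma Cc_mul a b : Cc a -> Cc b -> Cc (cc_mul act a b).
Proof.
move=> Ca Cb; have [Da hA] := Cc_fset Ca; have [Db hB] := Cc_fset Cb.
apply: (@Cc_of_fset _ [fset (s * t)%g | s in Da, t in Db]%fset) => t.
  move=> tD; rewrite (cc_mulE _ _ hA); rewrite big1_seq//= => s sD.
  suff -> : b (s^-1 * t)%g = 0.
    by apply/funext => x; rewrite /translate [LHS]/= mulr0.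
  apply: hB; apply: contra tD => sb; apply/imfset2P.
  by exists s => //=; exists (s^-1 * t)%g => //=; rewrite mulVKg.
rewrite (cc_mulE _ _ hA); apply: continuous_csum => s.
exact (continuous_cmul (@Cc_cont _ s Ca)
  (translate_cont (s:=s) (@Cc_cont _ (s^-1 * t)%g Cb))).
Qed.

Lemma mon_mul f s c :
  cc_mul act (mon f s) c = fun t => f * translate act s (c (s^-1 * t)%g).
Proof.
apply/funext => t; rewrite (@cc_mulE _ _ [fset s]%fset) => [|u].
  by rewrite big_seq_fset1 /mon eqxx.
by rewrite inE /mon => /negbTE ->.
Qed.

Lemma mon_mul_mon f s g t :
  cc_mul act (mon f s) (mon g t) = mon (f * translate act s g) (s * t)%g.
Proof.
rewrite mon_mul; apply/funext => u; rewrite /mon.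
rewrite -(inj_eq (mulgI s)) mulVKg; case: ifP => // _.
by apply/funext => x; rewrite /translate [LHS]/= mulr0.
Qed.

Lemma star_mon f s :
  cc_star act (mon f s) = mon (fun x => (f (act s x))^*) s^-1%g.
Proof.
apply/funext => t; rewrite /cc_star /translate /mon -(inj_eq invg_inj) invgK.
case: ifP => [/eqP ->|_]; first by rewrite invgK.
by apply/funext => x; rewrite conjC0.
Qed.

Lemma mon_star_mul f s : cc_mul act (cc_star act (mon f s)) (mon f s) =
  mon (fun x => (cmod (f (act s x)) ^+ 2)%:C) 1%g.
Proof.
rewrite star_mon mon_mul_mon mulVg; congr mon; apply/funext => x.
by rewrite -mulJc [LHS]/= /translate invgK.
Qed.

Lemma Cc_decomp a (D : {fset G}) : (forall t, t \notin D -> a t = 0) ->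
  a = \sum_(t <- D) mon (a t) t.
Proof.
move=> aD; apply/funext => t; rewrite fct_sumE /mon.
have [tD|tD] := boolP (t \in D).
  rewrite (big_fsetD1 t)//= eqxx big1_fset ?addr0// => u.
  by rewrite !inE eq_sym => /andP[/negbTE -> _].
rewrite aD// big1_seq// => u /=; case: ifP => // /eqP <- uD.
by rewrite uD in tD.
Qed.

Lemma mon_add f g s : mon f s + mon g s = mon (f + g) s.
Proof.
by apply/funext => t; rewrite fctE /mon; case: ifP => // _; rewrite addr0.
Qed.

Lemma cc_scale_mon (k : R[i]) f s :
  cc_scale k (mon f s) = mon (fun x => k * f x) s.
Proof.
apply/funext => t; apply/funext => x; rewrite /cc_scale /mon.
by case: ifP => // _; rewrite mulr0.
Qed.

Lemma cc_scaleN1 a : cc_scale (-1) a = - a.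
Proof. by apply/funext => t; apply/funext => x; rewrite /cc_scale mulN1r. Qed.

Lemma monE f s t : mon f s t = if t == s then f else 0.
Proof. by []. Qed.

Lemma cc_constE f : cc_const f = mon f (1%g : G).
Proof. by []. Qed.

Lemma mul_mon1 a g : Cc a ->
  cc_mul act a (mon g 1%g) = fun t => a t * translate act t g.
Proof.
move=> Ca; have [D aD] := Cc_fset Ca; apply/funext => t.
have aD' s : s \notin (t |` D)%fset -> a s = 0.
  by rewrite !inE negb_or => /andP[_ /aD].
rewrite (cc_mulE _ _ aD') (big_fsetD1 t) ?fset1U1//= big1_fset ?addr0.
  by rewrite mulVg monE eqxx.
move=> s; rewrite !inE => /andP[st _] _; rewrite monE.
rewrite -(inj_eq (mulgI s)) mulVKg mulg1 eq_sym (negbTE st).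
by apply/funext => x; rewrite /translate [LHS]/= mulr0.
Qed.

Lemma cc_scaleE (k : R[i]) a t x : cc_scale k a t x = k * a t x.
Proof. by []. Qed.

(** The substitution s = t^-1 in the convolution exhibits this coefficient as the l^2(G) inner
    product of t |-> a t (t x) and t |-> b t (t x). This is what identifies the GNS space of the
    evaluation at x. *)
Lemma cc_star_mul1 a b (D : {fset G}) x : (forall t, t \notin D -> a t = 0) ->
  cc_mul act (cc_star act a) b 1%g x =
  \sum_(t <- D) (a t (act t x))^* * b t (act t x).
Proof.
move=> aD; rewrite (@cc_mulE _ _ [fset t^-1%g | t in D]%fset) => [|t tD].
  rewrite big_imfset => [|? ? _ _ /invg_inj //].
  rewrite fct_sumE; apply: eq_bigr => t _.
  by rewrite [LHS]/= /cc_star /translate invgK mulg1.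
have at0 : a t^-1%g = 0.
  apply: aD; apply: contra tD => tD; apply/imfsetP; exists t^-1%g => //=.
  by rewrite invgK.
by apply/funext => y; rewrite /cc_star /translate at0 conjC0.
Qed.

Lemma cc_star_mul_supp a b (D : {fset G}) t x :
  (forall t, t \notin D -> a t = 0) ->
  cc_mul act (cc_star act a) b t x =
  \sum_(s <- D) (a s (act s x))^* * b (s * t)%g (act s x).
Proof.
move=> aD; rewrite (@cc_mulE _ _ [fset t^-1%g | t in D]%fset) => [|s sD].
  rewrite big_imfset => [|? ? _ _ /invg_inj //].
  rewrite fct_sumE; apply: eq_bigr => s _.
  by rewrite [LHS]/= /cc_star /translate !invgK.
have at0 : a s^-1%g = 0.
  apply: aD; apply: contra sD => sD; apply/imfsetP; exists s^-1%g => //=.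
  by rewrite invgK.
by apply/funext => y; rewrite /cc_star /translate at0 conjC0.
Qed.

End crossed_algebra.

(* Prevents the unifier from computing with complex numbers. *)
Global Opaque Cc cc_mul cc_star cc_scale mon.

(** * Positive functionals are dominated by the full norm *)

Lemma compact_cbounded (R : realType) (X : topologicalType) (f : X -> R[i]) :
  compact [set: X] -> continuous f ->
  exists2 M : R, 0 <= M & forall x, cmod (f x) <= M.
Proof.
move=> cX cf; have cm := continuous_cmod cf.
have : compact [set cmod (f x) | x in [set: X]].
  by apply: continuous_compact => //; exact: continuous_subspaceT.
move/compact_bounded => [M [_ /(_ (Num.max M 0 + 1))]].
have M0 : 0 <= Num.max M 0 by rewrite le_max lexx orbT.
have lt : M < Num.max M 0 + 1 by rewrite ltr_pwDr// le_max lexx.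
move=> /(_ lt) h.
exists (Num.max M 0 + 1); first by rewrite addr_ge0.
move=> x; have := h (cmod (f x)) (ex_intro2 _ _ x I erefl).
by rewrite /= ger0_norm ?cmod_ge0.
Qed.

Section full_crossed.
Variables (R : realType) (G : groupType) (X : topologicalType).
Variables (act : G -> X -> X) (B : cstarAlgType R).
Variable iota : (G -> X -> R[i]) -> B.
Hypotheses (cX : compact [set: X]) (actP : homeo_action act).
Hypothesis fcp : full_crossed_product act iota.
Implicit Types (a b c : G -> X -> R[i]) (f g h : X -> R[i]) (s t : G).

Let CcM a b : Cc a -> Cc b -> Cc (cc_mul act a b) := @Cc_mul _ _ _ _ actP a b.
Let CcS a : Cc a -> Cc (cc_star act a) := @Cc_star _ _ _ _ actP a.

Definition iota_img : set B := iota @` [set a | Cc a].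

Lemma iota0 : iota 0 = 0.
Proof.
have C0 := Cc0 R G X.
by apply: (addrI (iota 0)); rewrite -(fcpD fcp) // !addr0.
Qed.

Lemma iotaB a b : Cc a -> Cc b -> iota (a - b) = iota a - iota b.
Proof.
move=> Ca Cb; have CNb := Cc_scale (-1) Cb.
by rewrite -cc_scaleN1 (fcpD fcp Ca CNb) (fcpZ fcp (-1) Cb) scaleN1r.
Qed.

Lemma iota_inj a b : Cc a -> Cc b -> iota a = iota b -> a = b.
Proof.
move=> Ca Cb ab; apply/eqP; rewrite -subr_eq0; apply/eqP.
apply: (cnorm_eq0 (fcp_norm fcp)).
  by rewrite -cc_scaleN1; exact (Cc_add Ca (Cc_scale _ Cb)).
by rewrite iotaB// ab subrr normr0.
Qed.

Lemma dense_iota (v : B) (e : R) : 0 < e -> exists2 a, Cc a & nrm (v - iota a) < e.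
Proof.
move=> e0; have [_ [a Ca <-] h] := dense_nrmP (fcp_dense fcp) v e0.
by exists a.
Qed.

Lemma Cc1 : Cc (mon (1 : X -> R[i]) (1%g : G)).
Proof. exact (Cc_mon _ (@continuous_c1 R X)). Qed.

(** The unit is forced by multiplicativity and density: u - 1 annihilates the image of [iota], so u
    - 1 = (u - 1) (1 - iota a) is small as soon as iota a is close to 1. *)
Lemma iota1 : iota (mon 1 1%g) = 1.
Proof.
have h a : Cc a -> iota (mon 1 1%g) * iota a = iota a.
  move=> Ca; rewrite -(fcpM fcp Cc1 Ca); congr iota.
  rewrite (mon_mul _ 1 1%g a); apply/funext => t.
  by rewrite mul1r (translate1 actP) invg1 mul1g.
apply/eqP; rewrite -subr_eq0; apply/eqP/nrm_small => e e0.
pose u : B := iota (mon 1 1%g).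
have K0 : 0 < nrm (u - 1) + 1 by rewrite ltr_wpDl// nrm_ge0.
have [a Ca ha] := dense_iota 1 (divr_gt0 e0 K0).
have -> : iota (mon 1 1%g) - 1 = (u - 1) * (1 - iota a).
  by rewrite mulrBr mulr1 mulrBl (h _ Ca) mul1r subrr subr0.
apply: le_trans (nrmM _ _) _.
apply: le_trans (ler_wpM2l (nrm_ge0 _) (ltW ha)) _.
rewrite mulrC -mulrA ler_piMr ?(ltW e0)// mulrC ler_pdivrMr// mul1r.
by rewrite lerDl.
Qed.

Lemma iota_imgP : star_subalgebra iota_img.
Proof.
split.
- by exists (mon 1 1%g); [exact: Cc1|exact: iota1].
- move=> _ _ [a Ca <-] [b Cb <-].
  by exists (a + b); [exact (Cc_add Ca Cb)|exact (fcpD fcp Ca Cb)].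
- move=> k _ [a Ca <-].
  by exists (cc_scale k a); [exact (Cc_scale k Ca)|exact (fcpZ fcp k Ca)].
- move=> _ _ [a Ca <-] [b Cb <-].
  by exists (cc_mul act a b); [exact (CcM Ca Cb)|exact (fcpM fcp Ca Cb)].
- move=> _ [a Ca <-].
  by exists (cc_star act a); [exact (CcS Ca)|exact (fcp_star fcp Ca)].
Qed.

Lemma iota_sum (I : eqType) (r : seq I) (F : I -> G -> X -> R[i]) :
  (forall i, i \in r -> Cc (F i)) ->
  Cc (\sum_(i <- r) F i) /\ iota (\sum_(i <- r) F i) = \sum_(i <- r) iota (F i).
Proof.
elim: r => [|i r IH] CF.
  rewrite !big_nil iota0; split; last by [].
  exact: Cc0.
have [|Cr ir] := IH; first by move=> j jr; apply: CF; rewrite inE jr orbT.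
have Ci : Cc (F i) by apply: CF; rewrite inE eqxx.
by rewrite !big_cons; split; [exact (Cc_add Ci Cr)|rewrite (fcpD fcp Ci Cr) ir].
Qed.

(** Transport along [iota], well defined on the image because [iota] is injective on Cc. Elsewhere
    the value is the junk psi 0, which [positive_on] over the image never sees. *)
Definition descend (psi : (G -> X -> R[i]) -> R[i]) (b : B) : R[i] :=
  psi (xget 0 [set a | Cc a /\ iota a = b]).

Lemma descendE psi a : Cc a -> descend psi (iota a) = psi a.
Proof.
move=> Ca; rewrite /descend; case: xgetP => [c -> [Cc_c ca]|/(_ a)[]]; last by [].
by rewrite (iota_inj Cc_c Ca ca).
Qed.

Record positive_Cc (psi : (G -> X -> R[i]) -> R[i]) : Prop := PositiveCc {
  pCcD : forall a b, Cc a -> Cc b -> psi (a + b) = psi a + psi b;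
  pCcZ : forall k a, Cc a -> psi (cc_scale k a) = k * psi a;
  pCc_ge0 : forall a, Cc a -> 0 <= psi (cc_mul act (cc_star act a) a) }.

Lemma descend_positive psi : positive_Cc psi -> positive_on iota_img (descend psi).
Proof.
move=> psiP; split.
- move=> _ _ [a Ca <-] [b Cb <-]; have Cab := Cc_add Ca Cb.
  rewrite -(fcpD fcp Ca Cb) (descendE _ Cab) (descendE _ Ca) (descendE _ Cb).
  exact (pCcD psiP Ca Cb).
- move=> k _ [a Ca <-]; have Cka := Cc_scale k Ca.
  rewrite -(fcpZ fcp k Ca) (descendE _ Cka) (descendE _ Ca).
  exact (pCcZ psiP k Ca).
- move=> _ [a Ca <-]; have Csa := CcS Ca.
  rewrite -(fcp_star fcp Ca) -(fcpM fcp Csa Ca) (descendE _ (CcM Csa Ca)).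
  exact (pCc_ge0 psiP Ca).
Qed.

Section bounded.
Variable psi : B -> R[i].
Hypothesis psiP : positive_on iota_img psi.
Let S := iota_img.
Let SA := iota_imgP.

Definition left_bounded (a : B) := exists2 M : R, 0 <= M &
  forall b : B, S b -> psi_sqn psi (a * b) <= M * psi_sqn psi b.

Lemma left_boundedD (a b : B) : S a -> S b ->
  left_bounded a -> left_bounded b -> left_bounded (a + b).
Proof.
move=> Sa Sb [M M0 aM] [N N0 bN]; exists (2 * M + 2 * N).
  by rewrite addr_ge0// mulr_ge0.
move=> c Sc; have Sac := ssubM SA Sa Sc; have Sbc := ssubM SA Sb Sc.
rewrite [(a + b) * c]mulrDl.
have := psi_sqnD SA psiP Sac Sbc.
have := psi_sqn_ge0 psiP (ssubD SA Sac Sbc).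
move: (aM _ Sc) (bN _ Sc) (psi_sqn_ge0 psiP Sac) (psi_sqn_ge0 psiP Sbc).
set p := psi_sqn psi (a * c); set q := psi_sqn psi (b * c).
set r := psi_sqn psi c; set w := psi_sqn psi (a * c + b * c).
move=>  h1 h2 p0 q0 w0 h.
have : w <= 2 * p + 2 * q.
  rewrite -(sqr_sqrtr p0) -(sqr_sqrtr q0) -(sqr_sqrtr w0).
  move: (sqrtr_ge0 p) (sqrtr_ge0 q) (sqrtr_ge0 w) h.
  move: (Num.sqrt p) (Num.sqrt q) (Num.sqrt w) => x y z x0 y0 z0 h.
  have : z ^+ 2 <= (x + y) ^+ 2 by apply: lerXn2r; rewrite ?nnegrE ?addr_ge0.
  have -> : (x + y) ^+ 2 = 2 * x ^+ 2 + 2 * y ^+ 2 - (x - y) ^+ 2 by ring.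
  by move=> hz; apply: le_trans hz _; rewrite gerBl sqr_ge0.
move=> h3; rewrite mulrDl; apply: le_trans h3 _.
by rewrite -!mulrA lerD// ler_pM2l.
Qed.

(** For m = f u_s the product star m . m is the function |f (s x)|^2, so with M a bound of |f| and h
    the function sqrt (M^2 - |f (s x)|^2) one has star m . m + star h . h = M^2. Hence |m b|^2 + |h
    b|^2 = M^2 |b|^2. *)
Lemma left_bounded_mon f s : continuous f -> left_bounded (iota (mon f s)).
Proof.
move=> cf; have [M M0 fM] := compact_cbounded cX cf.
exists (M ^+ 2); first exact: sqr_ge0.
move=> b Sb; set m := iota _.
have Cm : Cc (mon f s) by exact: Cc_mon.
have Sm : S m by exists (mon f s).
pose k x : R := Num.sqrt (M ^+ 2 - cmod (f (act s x)) ^+ 2).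
have ck : continuous k.
  have [_ _ ca] := actP.
  have cfa : continuous (fun x => cmod (f (act s x))).
    apply: continuous_cmod => x.
    by apply: continuous_comp; [exact: ca|exact: cf].
  move=> x; apply: (@continuous_comp _ _ _
    (fun x => M ^+ 2 - cmod (f (act s x)) ^+ 2) (@Num.sqrt R)).
    apply: cvgB; first exact: cvg_cst.
    by rewrite /=; under eq_fun do rewrite expr2; rewrite expr2; apply: cvgM; exact: cfa.
  exact: sqrt_continuous.
have ckc := continuous_real ck.
set kc := (fun x => (k x)%:C) in ckc.
have Ch : Cc (mon kc (1%g : G)) by exact: Cc_mon.
pose h : B := iota (mon kc 1%g).
have Sh : S h by exists (mon kc 1%g).
have [Csm Csh] := (CcS Cm, CcS Ch).
have id : star m * m + star h * h = (M ^+ 2)%:C *: 1.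
  rewrite /m /h -(fcp_star fcp Cm) -(fcp_star fcp Ch).
  rewrite -(fcpM fcp Csm Cm) -(fcpM fcp Csh Ch).
  rewrite -(fcpD fcp (CcM Csm Cm) (CcM Csh Ch)) -iota1 -(fcpZ fcp _ Cc1).
  rewrite !mon_star_mul mon_add cc_scale_mon.
  congr (iota (mon _ _)); apply/funext => x.
  rewrite mulr1 fctE -rmorphD; congr (_%:C); rewrite /kc cmodR.
  have [a1 _ _] := actP; rewrite a1 real_normK ?num_real// /k sqr_sqrtr.
    by rewrite addrC subrK.
  by rewrite subr_ge0; apply: lerXn2r; rewrite ?nnegrE ?cmod_ge0.
have [Smb Shb] := (ssubM SA Sm Sb, ssubM SA Sh Sb).
have e : psi_sqn psi (m * b) + psi_sqn psi (h * b) = M ^+ 2 * psi_sqn psi b.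
  rewrite /psi_sqn -creD -(posD psiP).
  - have A (x : B) : star (x * b) * (x * b) = star b * (star x * x) * b.
      by rewrite starMr !mulrA.
    rewrite !A -mulrDl -mulrDr id -scalerAr mulr1 -scalerAl (posZ psiP) ?creRM//.
    exact: (ssubM SA (ssub_star SA Sb) Sb).
  - exact: (ssubM SA (ssub_star SA Smb) Smb).
  - exact: (ssubM SA (ssub_star SA Shb) Shb).
by rewrite -e lerDl (psi_sqn_ge0 psiP).
Qed.

Lemma left_bounded_all (a : B) : S a -> left_bounded a.
Proof.
move=> [c Cc_c <-]; have [D cD] := Cc_fset Cc_c.
rewrite (Cc_decomp cD).
have Cm t : Cc (mon (c t) t) by exact (Cc_mon t (@Cc_cont _ _ _ _ t Cc_c)).
rewrite (iota_sum (fun t _ => Cm t)).2.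
suff : S (\sum_(t <- D) iota (mon (c t) t)) /\
   left_bounded (\sum_(t <- D) iota (mon (c t) t)) by case.
elim/big_ind: _ => [|u v [Su bu] [Sv bv]|t _].
- split; first by rewrite -(scale0r (1 : B)); exact/(ssubZ SA)/(ssub1 SA).
  by exists 0 => // b Sb; rewrite !mul0r (psi_sqn0 SA psiP).
- by split; [exact: (ssubD SA)|exact: left_boundedD].
- split; first exact (ex_intro2 _ _ (mon (c t) t) (Cm t) erefl).
  exact (left_bounded_mon t (@Cc_cont _ _ _ _ t Cc_c)).
Qed.

(** A GNS seminorm may vanish on non-zero elements, while maximality of the full norm is asserted
    among definite norms only. The maximum with the full norm is definite, and it keeps the C-star
    identity because squaring is monotone on nonnegative reals. *)
Lemma nrm_le_gns (a : B) : S a -> gns_norm S psi a <= nrm a.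
Proof.
have lb := left_bounded_all.
pose q c : R[i] := (Num.max (gns_norm S psi (iota c)) (nrm (iota c)))%:C.
have SC c : Cc c -> S (iota c) by exists c.
have max0 c : 0 <= Num.max (gns_norm S psi (iota c)) (nrm (iota c)).
  by rewrite le_max gns_norm_ge0.
suff qP : cstar_norm act q.
  move=> [c Cc_c <-]; have := fcp_norm_max fcp qP Cc_c.
  by rewrite /q nrmE lecR ge_max => /andP[].
split.
- by move=> c _; rewrite ler0c.
- move=> c Cc_c /complexI m0; apply: (cnorm_eq0 (fcp_norm fcp) Cc_c).
  suff -> : `|iota c| = (nrm (iota c))%:C.
    by congr _%:C; apply/eqP; rewrite eq_le nrm_ge0 andbT -m0 le_max lexx orbT.
  exact: nrmE.
- move=> c d Cc_c Cc_d; rewrite /q -rmorphD lecR (fcpD fcp Cc_c Cc_d) ge_max.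
  apply/andP; split.
    apply: le_trans (gns_normD SA psiP lb (SC _ Cc_c) (SC _ Cc_d)) _.
    by rewrite lerD// le_max lexx.
  by apply: le_trans (nrmD _ _) _; rewrite lerD// le_max lexx orbT.
- move=> k c Cc_c; rewrite /q cmodE -rmorphM (fcpZ fcp k Cc_c) nrmZ.
  by rewrite (gns_normZ SA psiP lb _ (SC _ Cc_c)) maxr_pMr ?cmod_ge0.
- move=> c d Cc_c Cc_d; rewrite /q -rmorphM lecR (fcpM fcp Cc_c Cc_d) ge_max.
  apply/andP; split.
    apply: le_trans (gns_normM SA psiP lb (SC _ Cc_c) (SC _ Cc_d)) _.
    by rewrite ler_pM ?gns_norm_ge0// le_max lexx.
  by apply: le_trans (nrmM _ _) _; rewrite ler_pM ?nrm_ge0// le_max lexx orbT.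
- move=> c Cc_c; rewrite /q -rmorphXn (fcpM fcp (CcS Cc_c) Cc_c).
  rewrite (fcp_star fcp Cc_c) nrmX (gns_normX SA psiP lb (SC _ Cc_c)).
  congr _%:C; have [h|h] := leP (gns_norm S psi (iota c)) (nrm (iota c)).
    by apply: max_r; apply: lerXn2r; rewrite ?nnegrE ?gns_norm_ge0 ?nrm_ge0.
  apply: max_l; apply: lerXn2r; rewrite ?nnegrE ?gns_norm_ge0 ?nrm_ge0//.
  exact: ltW.
Qed.

Lemma positive_le_nrm (a : B) : psi 1 = 1 -> S a -> cmod (psi a) <= nrm a.
Proof.
move=> p1 Sa; apply: le_trans (nrm_le_gns Sa).
exact: (psi_le_gns SA psiP left_bounded_all p1 Sa).
Qed.

End bounded.

End full_crossed.

(** * States *)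

Section states.
Variables (R : realType) (B : cstarAlgType R).
Implicit Types (a b c : B) (phi : B -> R[i]).

Lemma star_subalgebraT : star_subalgebra [set: B].
Proof. by []. Qed.

Lemma stateD phi a b : state phi -> phi (a + b) = phi a + phi b.
Proof. by case=> sp _ _; have := sp 1 a b; rewrite scale1r mul1r. Qed.

Lemma state0 phi : state phi -> phi 0 = 0.
Proof.
by move=> st; apply: (addrI (phi 0)); rewrite -(stateD _ _ st) !addr0.
Qed.

Lemma stateZ phi (k : R[i]) a : state phi -> phi (k *: a) = k * phi a.
Proof.
move=> st; case: (st) => sp _ _; have := sp k a 0.
by rewrite addr0 (state0 st) addr0.
Qed.

Lemma state_positive phi : state phi -> positive_on [set: B] phi.
Proof.
move=> st; split=> *; [exact: stateD|exact: stateZ|by case: st].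
Qed.

Lemma stateB phi a b : state phi -> phi (a - b) = phi a - phi b.
Proof.
by move=> st; rewrite -scaleN1r (stateD _ _ st) (stateZ _ _ st) mulN1r.
Qed.

Lemma state_sum phi (I : Type) (r : seq I) (F : I -> B) : state phi ->
  phi (\sum_(i <- r) F i) = \sum_(i <- r) phi (F i).
Proof.
move=> st; elim: r => [|i r IH]; first by rewrite !big_nil (state0 st).
by rewrite !big_cons (stateD _ _ st) IH.
Qed.

Lemma state_cs phi b c : state phi ->
  cmod (phi (star b * c)) ^+ 2 <= psi_sqn phi b * psi_sqn phi c.
Proof.
by move=> st; apply: (cauchy_schwarz star_subalgebraT (state_positive st)).
Qed.

(** Continuity is not in the definition of [state]; it comes from positivity, as 1 - star b . b /
    |b|^2 is the square of a self-adjoint element by [cstar_sqrt]. *)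
Lemma state_sqn_le phi b : state phi -> psi_sqn phi b <= nrm b ^+ 2.
Proof.
move=> st; have [->|b0] := eqVneq b 0.
  by rewrite /psi_sqn mulr0 (state0 st) sqr_ge0.
have n0 : 0 < nrm b by rewrite lt_neqAle nrm_ge0 andbT eq_sym nrm_eq0.
set n := nrm b ^+ 2; have n20 : 0 < n by rewrite exprn_gt0.
pose a : B := (n^-1)%:C *: (star b * b).
have as_ : star a = a by rewrite starZr starMr starK.
have a1 : nrm a <= 1.
  rewrite nrmZr ger0_norm ?invr_ge0 ?(ltW n20)// nrmX mulVf ?lexx//.
  exact: lt0r_neq0.
have [y [ys _ y2 _]] := cstar_sqrt as_ a1.
have [_ pos one] := st.
have := pos (1 - y); rewrite starB star1 ys y2 (stateB _ _ st) one.
rewrite (stateZ _ _ st) => /ge0cP[_]; rewrite creD creN creRM /=.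
by rewrite subr_ge0 mulrC ler_pdivrMr// mul1r.
Qed.

Lemma state_le phi b : state phi -> cmod (phi b) <= nrm b.
Proof.
move=> st; rewrite -ler_sqr ?nnegrE ?cmod_ge0 ?nrm_ge0//.
apply: le_trans (state_sqn_le b st).
have [_ _ one] := st.
by have := state_cs 1 b st; rewrite /psi_sqn star1 !mul1r one mul1r.
Qed.

Lemma state_dist phi a b : state phi -> cmod (phi a - phi b) <= nrm (a - b).
Proof. by move=> st; rewrite -(stateB _ _ st) state_le. Qed.

Lemma state_dense_eq (S : set B) phi1 phi2 : dense S ->
  state phi1 -> state phi2 -> {in S, phi1 =1 phi2} -> phi1 = phi2.
Proof.
move=> dS s1 s2 e12; apply/funext => b; apply/eqP; rewrite -subr_eq0.
rewrite -cmod_eq0 eq_le cmod_ge0 andbT; apply/ler_addgt0Pr => e e0.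
have [a Sa ba] := dense_nrmP dS b (divr_gt0 e0 (ltr0n _ 2)).
have -> : phi1 b - phi2 b = (phi1 b - phi1 a) + (phi2 a - phi2 b).
  have -> : phi1 a = phi2 a by apply: e12; exact: mem_set.
  by ring.
rewrite add0r (splitr e) (le_trans (cmodD _ _))//.
have h1 := state_dist b a s1; have h2 := state_dist a b s2.
rewrite nrmB in h2.
by apply: lerD; [apply: le_trans h1 _|apply: le_trans h2 _]; exact: ltW.
Qed.

End states.

(** * Extension of a bounded positive functional from a dense star-subalgebra *)

Section extension.
Variables (R : realType) (B : cstarAlgType R) (S : set B) (psi : B -> R[i]).
Hypotheses (SA : star_subalgebra S) (psiP : positive_on S psi).
Hypotheses (dS : dense S) (psi_le : forall a, S a -> cmod (psi a) <= nrm a).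
Hypothesis psi1 : psi 1 = 1.
Implicit Types (a b c : B).

(* McShane's extension of a Lipschitz function *)
Definition mcshane b : R := inf [set complex.Re (psi a) + nrm (b - a) | a in S].

(** McShane's formula treats real functions, and the imaginary part of psi b is the real part of psi
    (- i b). By density any Lipschitz extension is the right one, so linearity and positivity can be
    checked afterwards. *)
Definition extend b : R[i] := mcshane b +i* mcshane (- 'i%C *: b).

Let psi_dist a a' : S a -> S a' ->
  complex.Re (psi a) - complex.Re (psi a') <= nrm (a - a').
Proof.
move=> Sa Sa'; rewrite -creN -creD -(posB SA psiP Sa Sa').
by apply: le_trans (ler_Re_cmod _) _; exact: psi_le (ssubB SA _ _).
Qed.

Lemma mcshane_dist a b : S a -> `|mcshane b - complex.Re (psi a)| <= nrm (b - a).
Proof.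
move=> Sa.
have lb a' : S a' ->
    complex.Re (psi a) - nrm (b - a) <= complex.Re (psi a') + nrm (b - a').
  move=> Sa'; have := psi_dist Sa Sa'; have := nrm_dist a a' b.
  by rewrite (nrmB a b); lra.
rewrite ler_distl; apply/andP; split.
  apply: lb_le_inf; first by exists (complex.Re (psi a) + nrm (b - a)), a.
  by move=> _ [a' Sa' <-]; exact: lb.
apply: ge_inf; last by exists a.
by exists (complex.Re (psi a) - nrm (b - a)) => _ [a' Sa' <-]; exact: lb.
Qed.

(** The factor 2 comes from estimating the real and imaginary parts separately. Every property of
    [extend] below is drawn from this estimate by approximation. *)
Lemma extend_dist a b : S a -> cmod (extend b - psi a) <= 2 * nrm (b - a).
Proof.
move=> Sa; apply: le_trans (ler_cmod_ReIm _) _.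
rewrite creD cimD creN cimN /= mulr_natl mulr2n.
apply: lerD; first exact: mcshane_dist.
have := mcshane_dist (- 'i%C *: b) (ssubZ SA (- 'i%C) Sa).
rewrite (posZ psiP _ Sa) -scalerBr nrmZ.
have -> : cmod (- 'i%C : R[i]) = 1.
  by rewrite /cmod normc_def /= oppr0 sqrrN expr1n expr0n add0r sqrtr1.
rewrite mul1r; apply: le_trans.
by rewrite creM /= oppr0 mul0r sub0r mulN1r opprK.
Qed.

Lemma extendE a : S a -> extend a = psi a.
Proof.
move=> Sa; apply/eqP; rewrite -subr_eq0 -cmod_eq0 eq_le cmod_ge0 andbT.
by have := extend_dist a Sa; rewrite subrr nrm0 mulr0.
Qed.

Let cmod_small (z : R[i]) (K : R) : 0 <= K ->
  (forall e : R, 0 < e -> cmod z <= K * e) -> z = 0.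
Proof.
move=> K0 h; apply/eqP; rewrite -cmod_eq0 eq_le cmod_ge0 andbT.
apply/ler_addgt0Pr => e e0; rewrite add0r.
have K1 : 0 < K + 1 by rewrite ltr_wpDl.
apply: le_trans (h (e / (K + 1)) (divr_gt0 e0 K1)) _.
by rewrite mulrCA ler_piMr ?(ltW e0)// ler_pdivrMr// mul1r lerDl.
Qed.

Lemma extend_linear (k : R[i]) b c : extend (k *: b + c) = k * extend b + extend c.
Proof.
apply/eqP; rewrite -subr_eq0; apply/eqP.
apply: (@cmod_small _ (4 * (cmod k + 1))) => [|e e0].
  by rewrite mulr_ge0// addr_ge0 ?cmod_ge0.
have [a Sa /ltW ba] := dense_nrmP dS b e0.
have [d Sd /ltW cd] := dense_nrmP dS c e0.
have Sk := ssubZ SA k Sa; have Skd := ssubD SA Sk Sd.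
have h1 := extend_dist (k *: b + c) Skd.
have h2 := extend_dist b Sa; have h3 := extend_dist c Sd.
rewrite (posD psiP Sk Sd) (posZ psiP _ Sa) in h1.
have hn : nrm (k *: b + c - (k *: a + d)) <= cmod k * e + e.
  rewrite opprD addrACA -scalerBr; apply: le_trans (nrmD _ _) _.
  by rewrite nrmZ lerD// ler_wpM2l ?cmod_ge0.
have -> : extend (k *: b + c) - (k * extend b + extend c) =
  (extend (k *: b + c) - (k * psi a + psi d)) +
  ((- k) * (extend b - psi a) - (extend c - psi d)) by ring.
apply: le_trans (cmodD _ _) _.
have h4 : cmod (- k * (extend b - psi a) - (extend c - psi d)) <=
    cmod k * (2 * e) + 2 * e.
  apply: le_trans (cmodD _ _) _; rewrite cmodM !cmodN; apply: lerD.
    rewrite ler_wpM2l ?cmod_ge0//; apply: le_trans h2 _.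
    by rewrite ler_pM2l.
  by apply: le_trans h3 _; rewrite ler_pM2l.
have -> : 4 * (cmod k + 1) * e = 2 * (cmod k * e + e) + (cmod k * (2 * e) + 2 * e).
  by ring.
by apply: lerD => //; apply: le_trans h1 _; rewrite ler_pM2l.
Qed.

Lemma extend_ge0 b : 0 <= extend (star b * b).
Proof.
have approx (e : R) : 0 < e -> exists2 r : R, 0 <= r &
    cmod (extend (star b * b) - r%:C) <= 2 * (2 * nrm b + 1) * e.
  (* The cap at 1 gives nrm a <= nrm b + 1, which keeps the error linear in e. *)
  move=> e0; have e10 : 0 < Num.min e 1 by rewrite lt_min e0 ltr01.
  have [a Sa /ltW ba] := dense_nrmP dS b e10.
  have Sas := ssub_star SA Sa; have Saa := ssubM SA Sas Sa.
  exists (psi_sqn psi a); first exact: (psi_sqn_ge0 psiP Sa).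
  rewrite -(psi_sqnE psiP Sa); apply: le_trans (extend_dist _ Saa) _.
  rewrite -mulrA ler_pM2l//.
  have /andP[be b1] : (nrm (b - a) <= e) && (nrm (b - a) <= 1).
    by move: ba; rewrite le_min.
  have an : nrm a <= nrm b + 1.
    have -> : a = b - (b - a) by rewrite opprB addrCA subrr addr0.
    by apply: le_trans (nrmD _ _) _; rewrite nrmN lerD.
  have -> : star b * b - star a * a = star b * (b - a) + star (b - a) * a.
    by rewrite starB mulrBr mulrBl addrA subrK.
  apply: le_trans (nrmD _ _) _.
  have -> : (2 * nrm b + 1) * e = nrm b * e + e * (nrm b + 1) by ring.
  apply: lerD; apply: le_trans (nrmM _ _) _; rewrite nrm_star.
    by rewrite ler_wpM2l ?nrm_ge0.
  by rewrite ler_pM ?nrm_ge0.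
set K := 2 * (2 * nrm b + 1) in approx.
have K0 : 0 < K by rewrite mulr_gt0// ltr_wpDl// mulr_ge0// nrm_ge0.
have approx' (e : R) : 0 < e -> exists2 r : R, 0 <= r &
    cmod (extend (star b * b) - r%:C) <= e.
  move=> e0; have [r r0] := approx _ (divr_gt0 e0 K0).
  by rewrite mulrCA divff ?mulr1 ?gt_eqF//; exists r.
apply/ge0cP; split.
  apply/eqP; rewrite -normr_le0; apply/ler_addgt0Pr => e /approx'[r r0 h].
  have := le_trans (ler_normIm_cmod _) h.
  by rewrite cimD cimN /= subr0 add0r.
apply/ler_addgt0Pr => e /approx'[r r0 h].
have := le_trans (ler_normRe_cmod _) h; rewrite creD creN /= ler_distl.
by move=> /andP[h1 _]; rewrite -lerBlDr; apply: le_trans h1; rewrite lerD2r.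
Qed.

Lemma extend_state : state extend.
Proof.
split; [exact: extend_linear|exact: extend_ge0|].
by rewrite extendE//; exact: ssub1 SA.
Qed.

End extension.

(** * Freeness and the evaluation states *)

Section evaluation_states.
Variables (R : realType) (G : groupType) (X : topologicalType).
Variables (act : G -> X -> X) (B : cstarAlgType R).
Variable iota : (G -> X -> R[i]) -> B.
Hypotheses (cX : compact [set: X]) (hX : hausdorff_space X).
Hypotheses (actP : homeo_action act) (freeP : free_action act).
Hypothesis fcp : full_crossed_product act iota.
Implicit Types (a b c : G -> X -> R[i]) (f g h : X -> R[i]) (s t : G) (x y : X).

Let CcM a b : Cc a -> Cc b -> Cc (cc_mul act a b) := @Cc_mul _ _ _ _ actP a b.
Let CcS a : Cc a -> Cc (cc_star act a) := @Cc_star _ _ _ _ actP a.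
Let act1 x : act 1%g x = x. Proof. by have [a1 _ _] := actP; rewrite a1. Qed.

(** Each t <> 1 in the list moves x, so x and t^-1 x have disjoint neighbourhoods; continuity pulls
    the second one back to x. The list has to be finite for the intersection to remain a
    neighbourhood, hence the restriction to finite supports. *)
Lemma free_nbhs x (r : seq G) : exists2 V : set X, nbhs x V &
  forall t y, t \in r -> t != 1%g -> V y -> ~ V (act t^-1%g y).
Proof.
elim: r => [|t r [V xV Vr]]; first by exists setT => //; exact: filterT.
have [->|t1] := eqVneq t 1%g.
  exists V => // s y; rewrite inE => /orP[/eqP->|]; last exact: Vr.
  by rewrite eqxx.
have tx : act t^-1%g x != x.
  apply/eqP; apply: freeP => /eqP.
  by rewrite -(inj_eq invg_inj) invgK invg1 (negbTE t1).
have hX' := hX; rewrite open_hausdorff in hX'.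
have [[P Q] /= [xP xQ] [oP oQ /eqP PQ]] := hX' _ _ tx.
move: xP xQ => /set_mem xP /set_mem xQ.
have [_ _ ca] := actP.
pose W := V `&` Q `&` (act t^-1%g @^-1` P).
exists W.
  apply: filterI; first by apply: filterI => //; exact: open_nbhs_nbhs.
  apply: ca; apply: open_nbhs_nbhs; split; [exact: oP|exact: xP].
move=> s y; rewrite inE => /orP[/eqP->|sr] s1 [[Vy Qy] Py] [[Vy' Qy'] Py'].
  have : (P `&` Q) (act t^-1%g y) by [].
  by rewrite PQ.
exact: Vr Vy Vy'.
Qed.

Lemma urysohn_nbhs x (U : set X) : nbhs x U ->
  exists h : X -> R, [/\ continuous h, h x = 1,
    forall y, ~ U y -> h y = 0 & forall y, 0 <= h y <= 1].
Proof.
rewrite nbhsE => -[V [oV Vx] VU].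
have nX : normal_space X by exact: compact_normal.
have [||||h [ch h0 h1 h01]] := @urysohn_ext_itv X R nX (~` V) [set x] 0 1.
- exact: open_closedC.
- exact: accessible_closed_set1 (hausdorff_accessible hX) x.
- by apply/seteqP; split=> // y [nV yx]; apply: nV; rewrite yx.
- exact: ltr01.
exists h; split=> //.
- by apply: h1; exists x.
- by move=> y Uy; apply: h0; exists y => // /VU.
- by move=> y; have /h01 : range h (h y) by exists y.
Qed.

Lemma cut_mul a (h : X -> R[i]) : Cc a -> continuous h ->
  cc_mul act (cc_mul act (mon h 1%g) a) (mon h 1%g) =
  fun t => h * a t * translate act t h.
Proof.
move=> Ca ch; have Ch := Cc_mon (1%g : G) ch.
rewrite (mul_mon1 _ _ (CcM Ch Ca)); apply/funext => t.
by rewrite mon_mul (translate1 actP) invg1 mul1g.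
Qed.

(* Freeness kills every Fourier coefficient but the one at 1 once [a] is cut
   down to a small neighbourhood of [x]. *)
Lemma cut_free a x (U : set X) : Cc a -> nbhs x U ->
  exists h : X -> R, [/\ continuous h, h x = 1,
    forall y, ~ U y -> h y = 0, forall y, 0 <= h y <= 1 &
    let hc y := (h y)%:C in
    cc_mul act (cc_mul act (mon hc 1%g) a) (mon hc 1%g) =
    mon (hc * a 1%g * hc) 1%g].
Proof.
move=> Ca xU; have [D aD] := Cc_fset Ca.
have [V xV VD] := free_nbhs x D.
have [h [ch hx h0 h01]] := urysohn_nbhs (filterI xU xV).
exists h; split=> //.
  by move=> y Uy; apply: h0 => -[].
move=> hc; rewrite (cut_mul Ca (continuous_real ch)).
apply/funext => t; rewrite monE; have [->|t1] := eqVneq t 1%g.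
  by rewrite (translate1 actP).
apply/funext => y.
transitivity (hc y * a t y * hc (act t^-1%g y)); first by [].
transitivity (0 : R[i]); last by [].
have [tD|/aD ->] := boolP (t \in D); last by rewrite mulr0 mul0r.
have [Vy|Vy] := pselect (V y).
  have -> : hc (act t^-1%g y) = 0.
    by rewrite /hc h0 // => -[_]; exact: VD.
  by rewrite mulr0.
by rewrite /hc (h0 y) ?mul0r// => -[].
Qed.

Definition cfun f : B := iota (mon f 1%g).

Lemma cfunE f : iota (cc_const f) = cfun f.
Proof. by rewrite cc_constE. Qed.

Lemma cfunM f g : continuous f -> continuous g -> cfun f * cfun g = cfun (f * g).
Proof.
move=> cf cg; rewrite -(fcpM fcp (Cc_mon _ cf) (Cc_mon _ cg)) mon_mul_mon.
by rewrite mulg1 (translate1 actP).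
Qed.

Lemma star_cfun f : continuous f -> star (cfun f) = cfun (fun x => (f x)^*).
Proof.
move=> cf; rewrite -(fcp_star fcp (Cc_mon _ cf)) star_mon invg1.
by congr (iota (mon _ _)); apply/funext => x; rewrite act1.
Qed.

Lemma cfun1 : cfun 1 = 1.
Proof. exact: (iota1 actP fcp). Qed.

Lemma cfunD f g : continuous f -> continuous g -> cfun f + cfun g = cfun (f + g).
Proof.
by move=> cf cg; rewrite -(fcpD fcp (Cc_mon _ cf) (Cc_mon _ cg)) mon_add.
Qed.

Lemma cfunZ (k : R[i]) f : continuous f -> k *: cfun f = cfun (fun x => k * f x).
Proof. by move=> cf; rewrite -(fcpZ fcp k (Cc_mon _ cf)) cc_scale_mon. Qed.

(** A real function bounded by 1 is the real part of the unitary r + i sqrt (1 - r^2), that is, the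
    mean of two elements of norm 1. *)
Lemma nrm_cfun_real (r : X -> R) : continuous r -> (forall x, `|r x| <= 1) ->
  nrm (cfun (fun x => (r x)%:C)) <= 1.
Proof.
move=> cr r1; pose q x := Num.sqrt (1 - r x * r x).
pose u x : R[i] := r x +i* q x.
have cu : continuous u.
  apply/continuousReIm; split; first exact: cr.
  move=> x; apply: (@continuous_comp _ _ _
    (fun x => 1 - r x * r x) (@Num.sqrt R)).
    by apply: cvgB; [exact: cvg_cst|apply: cvgM; exact: cr].
  exact: sqrt_continuous.
have q0 x : 0 <= 1 - r x * r x.
  by rewrite subr_ge0 -expr2 -real_normK ?num_real// exprn_ile1.
have uu : star (cfun u) * cfun u = 1.
  rewrite (star_cfun cu) (cfunM (continuous_conj cu) cu) -cfun1.
  congr cfun; apply/funext => x.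
  transitivity ((u x)^* * u x); first by [].
  rewrite mulJc cmod_sqr /= sqr_sqrtr// expr2 addrC subrK//.
have nu : nrm (cfun u) = 1.
  have := nrmX (cfun u); rewrite uu nrm1 => /esym/eqP.
  by rewrite sqrf_eq1 => /orP[/eqP//|/eqP h]; have := nrm_ge0 (cfun u); rewrite h ler0N1.
have -> : cfun (fun x => (r x)%:C) = (2^-1)%:C *: (cfun u + star (cfun u)).
  rewrite (star_cfun cu) (cfunD cu (continuous_conj cu)).
  rewrite (cfunZ _ (continuous_cadd cu (continuous_conj cu))).
  congr cfun; apply/funext => x.
  transitivity ((2^-1)%:C * (u x + (u x)^*)); last by [].
  by apply: complexP; rewrite /= ?subrr ?mulr0 ?mul0r ?subr0 ?addr0//; lra.
rewrite nrmZr ger0_norm ?invr_ge0// ler_pdivrMl// mulr1.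
by apply: le_trans (nrmD _ _) _; rewrite nrm_star nu.
Qed.

Lemma nrm_cfun f (M : R) : 0 < M -> continuous f -> (forall x, cmod (f x) <= M) ->
  nrm (cfun f) <= M.
Proof.
move=> M0 cf fM; have M20 : 0 < M ^+ 2 by rewrite exprn_gt0.
rewrite -ler_sqr ?nnegrE ?nrm_ge0 ?(ltW M0)// -nrmX.
rewrite (star_cfun cf) (cfunM (continuous_conj cf) cf).
pose r x := (M ^+ 2)^-1 * (cmod (f x) * cmod (f x)).
have cr : continuous r.
  move=> x; apply: cvgM; first exact: cvg_cst.
  by apply: cvgM; exact: continuous_cmod.
have r1 x : `|r x| <= 1.
  rewrite ger0_norm ?mulr_ge0 ?invr_ge0 ?cmod_ge0 ?(ltW M20)//.
  rewrite ler_pdivrMl// mulr1 -expr2.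
  by apply: lerXn2r; rewrite ?nnegrE ?cmod_ge0 ?(ltW M0).
have -> : cfun ((fun x => (f x)^*) * f) = (M ^+ 2)%:C *: cfun (fun x => (r x)%:C).
  rewrite (cfunZ _ (continuous_real cr)); congr cfun; apply/funext => x.
  transitivity ((f x)^* * f x); first by [].
  rewrite mulJc -rmorphM /r; congr (_%:C).
  by rewrite mulrA divff ?mul1r -?expr2// gt_eqF.
rewrite nrmZr ger0_norm ?(ltW M20)// ler_piMr ?(ltW M20)//.
exact: nrm_cfun_real.
Qed.

Definition ev x a : R[i] := a 1%g x.

Lemma ev_positive x : positive_Cc act (ev x).
Proof.
split=> [a b _ _ //|k a _|a Ca]; first by rewrite /ev cc_scaleE.
have [D aD] := Cc_fset Ca; rewrite /ev (cc_star_mul1 _ _ _ aD).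
by apply: sumr_ge0 => t _; rewrite mulJc ler0c sqr_ge0.
Qed.

Lemma ev_le x (v : B) : iota_img iota v -> cmod (descend iota (ev x) v) <= nrm v.
Proof.
apply: (positive_le_nrm cX actP fcp).
  exact: descend_positive (ev_positive x).
rewrite -(iota1 actP fcp) (descendE fcp _ (@Cc1 R G X)).
by rewrite /ev monE eqxx.
Qed.

Lemma dense_iota_img : dense (iota_img iota).
Proof. exact: fcp_dense fcp. Qed.

Definition phi x : B -> R[i] := extend (iota_img iota) (descend iota (ev x)).

Lemma phi_iota x a : Cc a -> phi x (iota a) = a 1%g x.
Proof.
move=> Ca; rewrite /phi (extendE (iota_imgP actP fcp)
  (descend_positive actP fcp (ev_positive x)) (@ev_le x)).
  exact: (descendE fcp).
by exists a.
Qed.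

Lemma phi_state x : state (phi x).
Proof.
apply: (extend_state (iota_imgP actP fcp)
  (descend_positive actP fcp (ev_positive x)) dense_iota_img (@ev_le x)).
rewrite -(iota1 actP fcp) (descendE fcp _ (@Cc1 R G X)).
by rewrite /ev monE eqxx.
Qed.

Lemma phi_cfun x f : continuous f -> phi x (cfun f) = f x.
Proof. by move=> cf; rewrite (phi_iota x (Cc_mon _ cf)) monE eqxx. Qed.

Section uniqueness.
Variables (x : X) (omega : B -> R[i]).
Hypothesis omegaS : state omega.
Hypothesis omega_ev : forall f, continuous f -> omega (cfun f) = f x.

Let csmall (z : R[i]) : cmod z ^+ 2 <= 0 -> z = 0.
Proof.
by rewrite exprn_even_le0//= cmod_eq0 => /eqP.
Qed.

(** C(X) lies in the multiplicative domain of omega: omega takes the value |f x|^2 = 0 at |f|^2, and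
    Cauchy-Schwarz removes the other factor. *)
Lemma state_mull f (v : B) : continuous f -> f x = 0 -> omega (cfun f * v) = 0.
Proof.
move=> cf fx; apply: csmall.
have cj := continuous_conj cf.
have := state_cs (star (cfun f)) v omegaS; rewrite starK => h.
apply: le_trans h _; rewrite {1}/psi_sqn starK (star_cfun cf) (cfunM cf cj).
have -> : omega (cfun (f * (fun x => (f x)^*))) = 0.
  rewrite (omega_ev (continuous_cmul cf cj)).
  by transitivity (f x * (f x)^*) => //; rewrite fx mul0r.
by rewrite mul0r.
Qed.

Lemma state_mulr f (v : B) : continuous f -> f x = 0 -> omega (v * cfun f) = 0.
Proof.
move=> cf fx; apply: csmall.
have cj := continuous_conj cf.
have := state_cs (star v) (cfun f) omegaS; rewrite starK => h.
apply: le_trans h _; rewrite {2}/psi_sqn (star_cfun cf) (cfunM cj cf).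
have -> : omega (cfun ((fun x => (f x)^*) * f)) = 0.
  rewrite (omega_ev (continuous_cmul cj cf)).
  by transitivity ((f x)^* * f x) => //; rewrite fx mulr0.
by rewrite mulr0.
Qed.

Lemma state_ev_unique : omega = phi x.
Proof.
apply: (state_dense_eq dense_iota_img omegaS (phi_state x)) => w.
move=> /set_mem[a Ca <-]; rewrite (phi_iota x Ca).
(* No smallness of the support is asked here beyond what freeness imposes. Multiplying by h on
   either side does not change omega, because 1 - h vanishes at x. *)
have [h [ch hx _ h01]] := cut_free Ca (@filterT _ (nbhs x) _).
move=> /=; set hc := (fun y => (h y)%:C) => cut.
have cc : continuous hc := continuous_real ch.
have c1 : continuous (1 : X -> R[i]) := @continuous_c1 R X.
pose g : X -> R[i] := fun y => (1 - h y)%:C.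
have cg : continuous g.
  by apply: continuous_real => y; apply: cvgB; [exact: cvg_cst|exact: ch].
have gx : g x = 0 by rewrite /g hx subrr.
have H1 : cfun hc + cfun g = 1.
  rewrite (cfunD cc cg) -cfun1; congr cfun; apply/funext => y.
  transitivity (hc y + g y) => //.
  by rewrite /hc /g -rmorphD addrC subrK.
have h1 v : omega v = omega (cfun hc * v).
  rewrite -{1}[v]mul1r -H1 mulrDl (stateD _ _ omegaS) (state_mull _ cg gx).
  by rewrite addr0.
have h2 v : omega v = omega (v * cfun hc).
  rewrite -{1}[v]mulr1 -H1 mulrDr (stateD _ _ omegaS) (state_mulr _ cg gx).
  by rewrite addr0.
have Ch := Cc_mon (1%g : G) cc.
rewrite h1 h2 /cfun -(fcpM fcp Ch Ca) -(fcpM fcp (CcM Ch Ca) Ch) cut.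
rewrite (omega_ev (continuous_cmul (continuous_cmul cc (@Cc_cont _ _ _ _ 1%g Ca)) cc)).
transitivity (hc x * a 1%g x * hc x) => //.
by rewrite /hc hx mul1r mulr1.
Qed.

End uniqueness.

(** Uniqueness holds among all states extending the evaluation, pure or not, and purity follows from
    it: if phi_x is a proper convex combination, each component vanishes at |g|^2 whenever g x = 0,
    so it also restricts to the evaluation at x. *)
Lemma free_pointT x : free_point (fun f => iota (cc_const f)) x.
Proof.
exists (phi x); split; last first.
  move=> om [[omS _] ome]; apply/esym; apply: (state_ev_unique omS) => f cf.
  by rewrite -cfunE ome.
split=> [|f cf]; last by rewrite cfunE phi_cfun.
split; first exact: phi_state.
have key (p1 p2 : B -> R[i]) (t : R) : state p1 -> state p2 -> 0 < t -> 0 < 1 - t ->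
    (forall b : B, phi x b = t%:C * p1 b + (1 - t)%:C * p2 b) -> p1 = phi x.
  move=> s1 s2 t0 t1 pE; apply: (state_ev_unique s1) => f cf.
  have z g : continuous g -> g x = 0 -> p1 (cfun g) = 0.
    move=> cg gx; have cgg := continuous_cmul (continuous_conj cg) cg.
    have := pE (star (cfun g) * cfun g).
    rewrite {1}(star_cfun cg) (cfunM (continuous_conj cg) cg) (phi_cfun _ cgg).
    have -> : ((fun x => (g x)^*) * g) x = 0.
      by transitivity ((g x)^* * g x) => //; rewrite gx mulr0.
    have sq0 : 0 <= psi_sqn p1 (cfun g).
      by apply: (psi_sqn_ge0 (state_positive s1)).
    have sq0' : 0 <= psi_sqn p2 (cfun g).
      by apply: (psi_sqn_ge0 (state_positive s2)).
    move/(congr1 (@complex.Re R)); rewrite creD !creRM /=.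
    rewrite -/(psi_sqn p1 _) -/(psi_sqn p2 _) => e0.
    have z1 : psi_sqn p1 (cfun g) = 0.
      apply/eqP; rewrite eq_le sq0 andbT -(pmulr_rle0 _ t0).
      have : 0 <= (1 - t) * psi_sqn p2 (cfun g) by rewrite mulr_ge0// ltW.
      by move: e0; lra.
    have := state_cs 1 (cfun g) s1; rewrite z1 mulr0 star1 mul1r.
    by rewrite exprn_even_le0//= cmod_eq0 => /eqP.
  pose g : X -> R[i] := f + (fun=> - f x).
  have cg : continuous g := continuous_cadd cf (@continuous_ccst R X (- f x)).
  have gx : g x = 0 by transitivity (f x - f x) => //; rewrite subrr.
  have c1 := @continuous_c1 R X.
  have fE : cfun f = f x *: cfun 1 + cfun g.
    rewrite (cfunZ _ c1) (cfunD _ cg).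
      congr cfun; apply/funext => y.
      transitivity (f x * 1 + (f y - f x)) => //.
      by rewrite mulr1 addrC subrK.
    exact (continuous_cmul (@continuous_ccst R X (f x)) c1).
  have [_ _ one] := s1.
  by rewrite fE (stateD _ _ s1) (stateZ _ _ s1) (z g cg gx) addr0 cfun1 one mulr1.
move=> p1 p2 t s1 s2 /andP[t0 t1] pE; split.
  by apply: (key p1 p2 t) => //; rewrite subr_gt0.
apply: (key p2 p1 (1 - t)) => //; first by rewrite subr_gt0.
  by rewrite opprB addrC subrK.
by move=> b; rewrite pE addrC; congr (_ + _%:C * _); rewrite opprB addrC subrK.
Qed.

(** For a bump function h at x, (1 - h) v is in J_x B and differs from v by h v, whose squared norm
    is that of h (v . star v) h. Up to a small error this cut-down is a function concentrated where
    the coefficient c(1) of an approximation c of v . star v is small, since c(1)(x) is close to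
    phi_x (v . star v) = 0. *)
Lemma JB_of_phi x (v : B) : phi x (v * star v) = 0 ->
  JB (fun f => iota (cc_const f)) x v.
Proof.
move=> v0; apply/closure_nrmP => e e0.
(* Two errors of at most d, from the approximation and from the cut-down function, add up to e^2 / 2
   < e^2. *)
pose d := e ^+ 2 / 4; have d0 : 0 < d by rewrite divr_gt0// exprn_gt0.
have [c Cc_c vc] := dense_iota fcp (v * star v) d0.
have cx : cmod (c 1%g x) < d.
  rewrite -(phi_iota x Cc_c) -[phi x _]subr0 -v0.
  apply: le_lt_trans vc; rewrite nrmB; exact: state_dist (phi_state x).
have cc1 : continuous (c 1%g) := @Cc_cont _ _ _ _ 1%g Cc_c.
have xU : nbhs x [set y | cmod (c 1%g y) < d].
  have cm := continuous_cmod cc1.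
  exact: (cvgr_lt (cmod (c 1%g x)) (cm x) _ cx).
have [h [ch hx h0 h01]] := cut_free Cc_c xU.
move=> /=; set hc := (fun y => (h y)%:C) => cut.
have cc : continuous hc := continuous_real ch.
pose g : X -> R[i] := fun y => (1 - h y)%:C.
have cg : continuous g.
  by apply: continuous_real => y; apply: cvgB; [exact: cvg_cst|exact: ch].
have gx : g x = 0 by rewrite /g hx subrr.
have H1 : cfun hc + cfun g = 1.
  rewrite (cfunD cc cg) -cfun1; congr cfun; apply/funext => y.
  transitivity (hc y + g y) => //.
  by rewrite /hc /g -rmorphD addrC subrK.
have Hs : star (cfun hc) = cfun hc.
  rewrite (star_cfun cc); congr cfun; apply/funext => y.
  exact: conjc_real.
have nH : nrm (cfun hc) <= 1.
  apply: nrm_cfun_real => // y; have /andP[? ?] := h01 y.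
  by rewrite ger0_norm.
exists (cfun g * v).
  exists 1%N, (fun=> 1), (fun=> cfun g * v); split.
    by move=> _; exists g, v; rewrite cfunE.
  by rewrite big_ord1 scale1r.
have -> : v - cfun g * v = cfun hc * v.
  by rewrite -{1}[v]mul1r -H1 mulrDl addrK.
rewrite -ltr_sqr ?nnegrE ?nrm_ge0 ?(ltW e0)// -nrmXr starMr Hs.
have -> : cfun hc * v * (star v * cfun hc) =
    cfun hc * (v * star v - iota c) * cfun hc + cfun (hc * c 1%g * hc).
  have Ch := Cc_mon (1%g : G) cc.
  rewrite {5}/cfun -cut (fcpM fcp (CcM Ch Cc_c) Ch) (fcpM fcp Ch Cc_c).
  by rewrite -/(cfun hc) mulrBr mulrBl subrK !mulrA.
apply: le_lt_trans (nrmD _ _) _.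
have n1 : nrm (cfun hc * (v * star v - iota c) * cfun hc) <= d.
  apply: le_trans (nrmM _ _) _; apply: le_trans (ler_wpM2l (nrm_ge0 _) nH) _.
  rewrite mulr1; apply: le_trans (nrmM _ _) _.
  apply: le_trans (ler_wpM2r (nrm_ge0 _) nH) _.
  by rewrite mul1r ltW.
have n2 : nrm (cfun (hc * c 1%g * hc)) <= d.
  apply: (nrm_cfun d0 (continuous_cmul (continuous_cmul cc cc1) cc)) => y.
  have -> : (hc * c 1%g * hc) y = hc y * c 1%g y * hc y by [].
  have /andP[hy0 hy1] := h01 y; rewrite !cmodM /hc cmodR ger0_norm//.
  have [/= cy|/h0 ->] := pselect ([set y | cmod (c 1%g y) < d] y).
    apply: (@le_trans _ _ (1 * d * 1)); last by rewrite mulr1 mul1r.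
    by rewrite ler_pM ?mulr_ge0 ?cmod_ge0// ler_pM ?cmod_ge0// ltW.
  by rewrite !mul0r ltW.
apply: le_lt_trans (lerD n1 n2) _; rewrite /d.
have : 0 < e ^+ 2 by rewrite exprn_gt0.
by move: (e ^+ 2) => E; lra.
Qed.

End evaluation_states.

(** * The invariant measure as a state *)

Section integration.
Variables (R : realType) (X : ptopologicalType).
Variable mu : probability (borel X) R.
Hypothesis cX : compact [set: X].
Implicit Types (f g : X -> R[i]) (r : X -> R).

Lemma continuous_borel r : continuous r ->
  measurable_fun [set: borel X] (r : borel X -> R).
Proof.
move=> /continuousP cr; apply: (measurability _ (measurable_realfun.RGenOpens.measurableE R)).
move=> _ [_ [a [b ->] <-]]; rewrite setTI; apply: sub_sigma_algebra.
exact/cr/interval_open.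
Qed.

Lemma act_borel (h : X -> X) : continuous h ->
  measurable_fun [set: borel X] (h : borel X -> borel X).
Proof.
move=> /continuousP ch; apply: (@measurability _ _ (borel X) (borel X) setT h (@open X)) => //.
move=> _ [U oU <-]; rewrite setTI; apply: sub_sigma_algebra.
exact: ch.
Qed.

Lemma continuous_integrable r : continuous r ->
  mu.-integrable [set: borel X] (EFin \o (r : borel X -> R)).
Proof.
move=> cr; apply: measurable_bounded_integrable => //.
- exact: (le_lt_trans (probability_le1 mu (@measurableT _ (borel X))) (ltry 1)).
- exact: continuous_borel.
have [M M0 rM] := compact_cbounded cX (continuous_real cr).
exists M; split; first exact: num_real.
move=> y My x _; have := rM x; rewrite cmodR => h.
by apply: le_trans h _; exact: ltW.
Qed.

Definition cint f : R[i] :=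
  (\int[mu]_(x in [set: borel X]) complex.Re (f x)) +i*
  (\int[mu]_(x in [set: borel X]) complex.Im (f x)).

Lemma cintD f g : continuous f -> continuous g ->
  cint (f + g) = cint f + cint g.
Proof.
move=> /continuousReIm[fr fi] /continuousReIm[gr gi].
apply: complexP; rewrite ?creD ?cimD /=.
  rewrite -RintegralD //; try exact: continuous_integrable.
  by apply: eq_Rintegral => x _; exact: creD.
rewrite -RintegralD //; try exact: continuous_integrable.
by apply: eq_Rintegral => x _; exact: cimD.
Qed.

Lemma cintZ (k : R[i]) f : continuous f -> cint (fun x => k * f x) = k * cint f.
Proof.
move=> /continuousReIm[fr fi].
have Z (l : R) r : continuous r -> continuous (fun x => l * r x).
  by move=> cr x; apply: cvgM; [exact: cvg_cst|exact: cr].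
apply: complexP; rewrite ?creM ?cimM /=.
  rewrite -!RintegralZl //; try exact: continuous_integrable.
  rewrite -RintegralB //; try exact/continuous_integrable/Z.
  by apply: eq_Rintegral => x _; exact: creM.
rewrite -!RintegralZl //; try exact: continuous_integrable.
rewrite -RintegralD //; try exact/continuous_integrable/Z.
by apply: eq_Rintegral => x _; exact: cimM.
Qed.

Lemma cint0 : cint 0 = 0.
Proof.
have := cintZ 0 (@continuous_c0 R X).
by rewrite mul0r => <-; congr cint; apply/funext => x; rewrite mul0r.
Qed.

Lemma cint1 : cint 1 = 1.
Proof.
apply: complexP => /=.
  rewrite Rintegral_cst//= -[X in fine X]/(mu _) probability_setT /=.
  by rewrite mulr1.
by rewrite Rintegral_cst//= mul0r.
Qed.

Lemma cint_sum (I : Type) (s : seq I) (F : I -> X -> R[i]) :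
  (forall i, continuous (F i)) ->
  cint (\sum_(i <- s) F i) = \sum_(i <- s) cint (F i).
Proof.
move=> cF; elim: s => [|i s IH]; first by rewrite !big_nil cint0.
by rewrite !big_cons (cintD (cF i) (continuous_csum (r:=s) cF)) IH.
Qed.

Lemma cint_ge0 r : (forall x, 0 <= r x) -> 0 <= cint (fun x => (r x)%:C).
Proof.
move=> r0; apply/ge0cP; split=> /=; first by rewrite Rintegral_cst//= mul0r.
by apply: Rintegral_ge0 => x _.
Qed.

Section invariance.
Variable h : X -> X.
Hypotheses (ch : continuous h)
  (hmu : forall A : set (borel X), measurable A -> mu (h @^-1` A) = mu A).

Lemma Rintegral_inv r : continuous r ->
  \int[mu]_(x in [set: borel X]) r (h x) = \int[mu]_(x in [set: borel X]) r x.
Proof.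
move=> cr; rewrite /Rintegral; congr fine.
have mh := act_borel ch.
have crh : continuous (r \o h).
  by move=> x; apply: continuous_comp; [exact: ch|exact: cr].
have := @integral_pushforward _ _ _ _ R _ mh mu setT (EFin \o r).
rewrite preimage_setT => <- //.
- apply: eq_measure_integral => A mA _; exact: hmu.
- by apply/measurable_realfun.measurable_EFinP; exact: (continuous_borel cr).
- exact: continuous_integrable crh.
Qed.

Lemma cint_inv f : continuous f -> cint (fun x => f (h x)) = cint f.
Proof.
move=> /continuousReIm[fr fi].
by apply: complexP => /=; [exact: (Rintegral_inv fr)|exact: (Rintegral_inv fi)].
Qed.

End invariance.

End integration.

Section invariant_state.
Variables (R : realType) (G : groupType) (X : ptopologicalType).
Variables (act : G -> X -> X) (mu : probability (borel X) R).
Hypotheses (cX : compact [set: X]) (actP : homeo_action act).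
Hypothesis muP : invariant_measure act mu.
Implicit Types (a b c : G -> X -> R[i]) (f g h : X -> R[i]) (s t : G).

Lemma act_preimage s (A : set X) : act s @^-1` A = act s^-1%g @` A.
Proof.
have [a1 aM _] := actP.
apply/seteqP; split=> [x Ax|_ [x Ax <-]].
  by exists (act s x) => //; rewrite -aM mulVg a1.
by rewrite /preimage /= -aM mulgV a1.
Qed.

Lemma cint_act s f : continuous f -> cint mu (fun x => f (act s x)) = cint mu f.
Proof.
have [_ _ ca] := actP.
move=> cf; apply: (cint_inv cX (ca s)) => // A mA.
by rewrite act_preimage muP.
Qed.

(** The vector state of the constant function 1 in the Koopman representation on L^2(X, mu), where
    every u_s fixes that vector. *)
Definition omega a : R[i] := \sum_(t \in [set: G]) cint mu (a t).

Lemma omegaE a (D : {fset G}) : (forall t, t \notin D -> a t = 0) ->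
  omega a = \sum_(t <- D) cint mu (a t).
Proof.
by move=> aD; rewrite /omega (fsbigTE D)// => t /aD ->; exact: cint0.
Qed.

Lemma omega_mon f s : continuous f -> omega (mon f s) = cint mu f.
Proof.
move=> cf; rewrite (@omegaE _ [fset s]%fset) => [|t].
  by rewrite big_seq_fset1 monE eqxx.
by rewrite inE monE => /negbTE ->.
Qed.

(** Translating each integral by invariance of mu, the value at star a . a becomes the double sum of
    the integrals of (a s)^* a t, which is the integral of |sum_t a t|^2. *)
Lemma omega_positive : positive_Cc act omega.
Proof.
split.
- move=> a b Ca Cb; have [D aD] := Cc_fset Ca; have [E bE] := Cc_fset Cb.
  have aDE t : t \notin (D `|` E)%fset -> a t = 0.
    by rewrite inE negb_or => /andP[/aD].
  have bDE t : t \notin (D `|` E)%fset -> b t = 0.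
    by rewrite inE negb_or => /andP[_ /bE].
  rewrite (omegaE aDE) (omegaE bDE) (@omegaE _ (D `|` E)%fset) => [|t tDE].
    rewrite -big_split; apply: eq_bigr => t _ /=.
    exact (cintD mu cX (@Cc_cont _ _ _ _ t Ca) (@Cc_cont _ _ _ _ t Cb)).
  by transitivity (a t + b t); [by []|rewrite (aDE _ tDE) (bDE _ tDE) addr0].
- move=> k a Ca; have [D aD] := Cc_fset Ca.
  rewrite (omegaE aD) (@omegaE _ D) => [|t tD].
    rewrite big_distrr; apply: eq_bigr => t _ /=.
    rewrite -(cintZ mu cX k (@Cc_cont _ _ _ _ t Ca)).
    by congr cint; apply/funext => x; exact: cc_scaleE.
  by apply/funext => x; rewrite cc_scaleE (aD _ tD) mulr0.
move=> a Ca; have [D aD] := Cc_fset Ca.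
have ca t : continuous (a t) := @Cc_cont _ _ _ _ t Ca.
have [_ _ cact] := actP.
pose H s t : X -> R[i] := (fun x => (a s x)^*) * a t.
have cH s t : continuous (H s t) := continuous_cmul (continuous_conj (ca s)) (ca t).
have cHs s t : continuous (fun x => H s t (act s x)).
  by move=> x; apply: continuous_comp; [exact: cact|exact: cH].
(* This set contains the support of star a . a, and for s in D the elements s t with t in E exhaust
   D. *)
pose E := [fset (s^-1 * t)%g | s in D, t in D]%fset.
have aaE t : cc_mul act (cc_star act a) a t =
    \sum_(s <- D) (fun x => H s (s * t)%g (act s x)).
  by apply/funext => x; rewrite (cc_star_mul_supp _ _ _ _ aD) fct_sumE.
have notE s t : s \in D -> t \notin E -> (s * t)%g \notin D.
  move=> sD; apply: contra => stD; apply/imfset2P.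
  by exists s => //=; exists (s * t)%g => //=; rewrite mulKg.
have H0 s t : t \notin D -> H s t = 0.
  move=> tD; apply/funext => x.
  transitivity ((a s x)^* * a t x); first by [].
  by rewrite (aD _ tD) mulr0.
rewrite (@omegaE _ E) => [|t tE]; last first.
  rewrite aaE big1_seq// => s /= sD; rewrite H0//; exact: notE.
have -> : \sum_(t <- E) cint mu (cc_mul act (cc_star act a) a t) =
    \sum_(s <- D) \sum_(t <- E) cint mu (H s (s * t)%g).
  rewrite exchange_big; apply: eq_bigr => t _ /=.
  rewrite aaE (cint_sum mu cX _ (fun s => @cHs s (s * t)%g)).
  by apply: eq_bigr => s _; rewrite (cint_act s (cH s (s * t)%g)).
have -> : \sum_(s <- D) \sum_(t <- E) cint mu (H s (s * t)%g) =
    cint mu (fun x => (cmod ((\sum_(t <- D) a t) x) ^+ 2)%:C).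
  have -> : (fun x => (cmod ((\sum_(t <- D) a t) x) ^+ 2)%:C) =
      \sum_(s <- D) \sum_(t <- D) H s t.
    apply/funext => x; rewrite -mulJc !fct_sumE rmorph_sum big_distrl.
    apply: eq_bigr => s _ /=; rewrite fct_sumE big_distrr.
    by apply: eq_bigr.
  rewrite (cint_sum mu cX _ (fun s => @continuous_csum _ _ _ _ _ (cH s))).
  apply: eq_big_seq => s sD; rewrite (cint_sum mu cX _ (cH s)).
  rewrite -(fsbigTE E (fun t => cint mu (H s (s * t)%g))) => [|t tE].
    rewrite -(fsbigTE D (fun t => cint mu (H s t))) => [|t tD].
      have bij : bijective (fun t => s * t)%g.
        by exists (fun t => s^-1 * t)%g => t; rewrite ?mulKg ?mulVKg.
      by rewrite [RHS](reindex_fsbigT (fun t => s * t)%g _ bij).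
    by rewrite H0// cint0.
  by rewrite H0 ?cint0//; exact: notE.
by apply: cint_ge0 => x; exact: sqr_ge0.
Qed.

End invariant_state.

(** * Non-amenability as a spectral gap *)

Section sums_over_group.
Variables (R : realType) (G : groupType).

Lemma gsum_shift (V : nmodType) (F : G -> V) (s : G) :
  \sum_(t \in [set: G]) F (s * t)%g = \sum_(t \in [set: G]) F t.
Proof.
have bij : bijective (fun t => s * t)%g.
  by exists (fun t => s^-1 * t)%g => t; rewrite ?mulKg ?mulVKg.
by rewrite [RHS](reindex_fsbigT (fun t => s * t)%g _ bij).
Qed.

Definition l2sq (xi : G -> R[i]) : R := \sum_(t \in [set: G]) cmod (xi t) ^+ 2.

Lemma l2sqE xi (D : {fset G}) : (forall t, t \notin D -> xi t = 0) ->
  l2sq xi = \sum_(t <- D) cmod (xi t) ^+ 2.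
Proof.
move=> xD; rewrite /l2sq (fsbigTE D)// => t /xD ->.
by rewrite /cmod normr0 expr0n.
Qed.

Definition gdiff (xi : G -> R[i]) (s t : G) : R[i] := xi (s^-1 * t)%g - xi t.

Lemma gdiff_supp xi (D : {fset G}) s : (forall t, t \notin D -> xi t = 0) ->
  forall t, t \notin (D `|` [fset s * u | u in D]%g)%fset -> gdiff xi s t = 0.
Proof.
move=> xD t; rewrite inE negb_or => /andP[tD tsD].
rewrite /gdiff (xD _ tD) xD ?subrr//; apply: contra tsD => h.
by apply/imfsetP; exists (s^-1 * t)%g => //=; rewrite mulVKg.
Qed.

Lemma l2sq_gdiff_ge0 xi (D : {fset G}) s : (forall t, t \notin D -> xi t = 0) ->
  0 <= l2sq (gdiff xi s).
Proof.
move=> xD; rewrite (l2sqE (gdiff_supp (s:=s) xD)).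
by apply: sumr_ge0 => t _; exact: sqr_ge0.
Qed.

(** The counterexamples to a gap e for S, each bundled with a finite set carrying its support. The
    strict inequality excludes xi = 0. *)
Definition almost_invariant (S : seq G) (e : R) : set ({fset G} * (G -> R[i])) :=
  [set p : {fset G} * (G -> R[i]) | (forall t, t \notin p.1 -> p.2 t = 0) /\
           \sum_(s <- S) l2sq (gdiff p.2 s) < e * l2sq p.2].

Definition mean (f : G -> R) (p : {fset G} * (G -> R[i])) : R :=
  (\sum_(t <- p.1) f t * cmod (p.2 t) ^+ 2) / \sum_(t <- p.1) cmod (p.2 t) ^+ 2.

Lemma almost_invariant_gt0 S e p : 0 < e -> almost_invariant S e p ->
  0 < \sum_(t <- p.1) cmod (p.2 t) ^+ 2.
Proof.
move=> e0 [pD h]; rewrite -(l2sqE pD) -(pmulr_rgt0 _ e0).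
apply: le_lt_trans h; apply: sumr_ge0 => s _; exact: l2sq_gdiff_ge0 pD.
Qed.

Lemma mean_bound f K p : (forall t, `|f t| <= K) -> `|mean f p| <= K.
Proof.
move=> fK; have K0 : 0 <= K by apply: le_trans (normr_ge0 _) (fK 1%g).
set L := \sum_(t <- p.1) cmod (p.2 t) ^+ 2.
have L0 : 0 <= L by apply: sumr_ge0 => t _; exact: sqr_ge0.
(* Division by 0 gives 0, so the bound holds for every pair, as the compactness argument along an
   ultrafilter wants. *)
rewrite /mean -/L; have [->|Ln] := eqVneq L 0; first by rewrite invr0 mulr0 normr0.
have Lp : 0 < L by rewrite lt_neqAle eq_sym Ln.
rewrite normrM normfV (ger0_norm L0) ler_pdivrMr// mulr_sumr.
apply: le_trans (ler_norm_sum _ _ _) _; apply: ler_sum => t _.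
by rewrite normrM (ger0_norm (sqr_ge0 _)) ler_wpM2r ?sqr_ge0.
Qed.

(** The left side is at most |a - b| (|a| + |b|), split by a weighted arithmetic-geometric
    inequality. Being linear in the squares, the bound can be summed over G termwise, in place of
    Cauchy-Schwarz in l^2. *)
Lemma sqr_cmod_dist (a b : R[i]) (h : R) : 0 < h ->
  `|cmod a ^+ 2 - cmod b ^+ 2| <=
  h * (cmod a ^+ 2 + cmod b ^+ 2) + h^-1 * cmod (a - b) ^+ 2.
Proof.
move=> h0; set x := cmod a; set y := cmod b; set z := cmod (a - b).
have [x0 y0 z0] : [/\ 0 <= x, 0 <= y & 0 <= z] by rewrite !cmod_ge0.
have xy : `|x - y| <= z.
  have le (c d : R[i]) : cmod c - cmod d <= cmod (c - d).
    by rewrite lerBlDr -{1}(subrK d c) cmodD.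
  by rewrite ler_norml le andbT lerNl opprB /z -(cmodN (a - b)) opprB le.
rewrite subr_sqr normrM (ger0_norm (addr_ge0 x0 y0)).
apply: le_trans (ler_wpM2r (addr_ge0 x0 y0) xy) _.
pose w := h^-1 * z; have zE : z = h * w by rewrite /w mulVKf// gt_eqF.
have -> : h^-1 * z ^+ 2 = h * w ^+ 2.
  by rewrite zE; move: (w) => v; field; exact: lt0r_neq0.
rewrite zE -mulrA -mulrDr ler_pM2l// -subr_ge0.
have -> : x ^+ 2 + y ^+ 2 + w ^+ 2 - w * (x + y) =
  (x - w / 2) ^+ 2 + (y - w / 2) ^+ 2 + w ^+ 2 / 2 by field.
by rewrite !addr_ge0 ?divr_ge0 ?sqr_ge0.
Qed.

(** Reindexing moves the translation from f to the weights |xi|^2; [sqr_cmod_dist] then bounds their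
    total change by 2 h |xi|^2 + h^-1 |s xi - xi|^2. *)
Lemma mean_shift S e f K s p (h : R) : 0 < e -> 0 < h ->
  (forall t, `|f t| <= K) -> s \in S -> almost_invariant S e p ->
  `|mean (fun t => f (s^-1 * t)%g) p - mean f p| <= K * (2 * h + h^-1 * e).
Proof.
move=> e0 h0 fK sS pA; have Lp := almost_invariant_gt0 e0 pA.
have K0 : 0 <= K by apply: le_trans (normr_ge0 _) (fK 1%g).
case: p pA Lp => D xi [/= xD hS]; rewrite /mean /= -(l2sqE xD) => Lp.
pose w t := cmod (xi t) ^+ 2.
have w0 t : t \notin D -> w t = 0.
  by move=> tD; rewrite /w xD// /cmod normr0 expr0n.
(* A common finite set of summation for the weights and for their translate t |-> w (s t). *)
pose E := (D `|` [fset s^-1 * u | u in D]%g)%fset.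
have ED t : t \notin E -> t \notin D by rewrite inE negb_or => /andP[].
have EsD t : t \notin E -> (s * t)%g \notin D.
  rewrite inE negb_or => /andP[_]; apply: contra => h1.
  by apply/imfsetP; exists (s * t)%g => //=; rewrite mulKg.
have s1 : \sum_(t <- D) f (s^-1 * t)%g * w t = \sum_(t <- E) f t * w (s * t)%g.
  rewrite -(fsbigTE D (fun t => f (s^-1 * t)%g * w t)) => [|t /w0 ->]; last by rewrite mulr0.
  rewrite -(gsum_shift _ s) (fsbigTE E) => [|t /EsD/w0 ->]; last by rewrite mulr0.
  by apply: eq_bigr => t _; rewrite mulKg.
have s2 : \sum_(t <- D) f t * w t = \sum_(t <- E) f t * w t.
  rewrite -(fsbigTE D (fun t => f t * w t)) => [|t /w0 ->]; last by rewrite mulr0.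
  by rewrite (fsbigTE E) => // t /ED/w0 ->; rewrite mulr0.
have L1 : l2sq xi = \sum_(t <- E) w t.
  by rewrite /l2sq (fsbigTE E) => // t /ED/w0.
have L2 : l2sq xi = \sum_(t <- E) w (s * t)%g.
  by rewrite /l2sq -(gsum_shift _ s) (fsbigTE E) => // t /EsD/w0.
have T : l2sq (gdiff xi s) = \sum_(t <- E) cmod (xi (s * t)%g - xi t) ^+ 2.
  rewrite /l2sq -(gsum_shift _ s) (fsbigTE E) => [|t tE].
    by apply: eq_bigr => t _; rewrite /gdiff mulKg -cmodN opprB.
  by rewrite /gdiff mulKg (xD _ (ED _ tE)) (xD _ (EsD _ tE)) subrr /cmod normr0 expr0n.
have Ts : l2sq (gdiff xi s) <= e * l2sq xi.
  apply: ltW; apply: le_lt_trans hS; rewrite (big_rem s)//= lerDl.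
  by apply: sumr_ge0 => u _; exact: l2sq_gdiff_ge0 xD.
rewrite -mulrBl normrM normfV (ger0_norm (ltW Lp)) ler_pdivrMr//.
rewrite s1 s2 -sumrB; apply: le_trans (ler_norm_sum _ _ _) _.
apply: (@le_trans _ _ (\sum_(t <- E) K * (h * (w (s * t)%g + w t) +
    h^-1 * cmod (xi (s * t)%g - xi t) ^+ 2))).
  apply: ler_sum => t _; rewrite -mulrBr normrM.
  by apply: ler_pM => //; exact: sqr_cmod_dist.
rewrite -mulr_sumr -mulrA ler_wpM2l// big_split/= -!mulr_sumr big_split/=.
rewrite -L1 -L2 -T.
have : h^-1 * l2sq (gdiff xi s) <= h^-1 * (e * l2sq xi).
  by rewrite ler_pM2l ?invr_gt0.
have -> : (2 * h + h^-1 * e) * l2sq xi =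
  h * (l2sq xi + l2sq xi) + h^-1 * (e * l2sq xi) by ring.
by rewrite lerD2l.
Qed.

Lemma meanD f g p : mean (f + g) p = mean f p + mean g p.
Proof.
rewrite /mean -mulrDl -big_split; congr (_ / _).
by apply: eq_bigr => t _; rewrite [RHS]/= -mulrDl.
Qed.

Lemma meanZ c f p : mean (fun t => c * f t) p = c * mean f p.
Proof.
rewrite /mean mulrA mulr_sumr; congr (_ / _).
by apply: eq_bigr => t _; rewrite mulrA.
Qed.

Lemma mean_ge0 f p : (forall t, 0 <= f t) -> 0 <= mean f p.
Proof.
move=> f0; apply: divr_ge0; apply: sumr_ge0 => t _; last exact: sqr_ge0.
by rewrite mulr_ge0 ?sqr_ge0.
Qed.

Lemma mean1 S e p : 0 < e -> almost_invariant S e p -> mean (fun=> 1) p = 1.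
Proof.
move=> e0 pA; have Lp := almost_invariant_gt0 e0 pA; rewrite /mean.
under eq_bigr do rewrite mul1r.
by rewrite divff// gt_eqF.
Qed.

Lemma bounded_funP (f : G -> R) : bounded_fun f ->
  exists K, forall t, `|f t| <= K.
Proof.
move=> [M [_ /(_ (M + 1))]]; rewrite ltrDl ltr01 => /(_ isT) h.
by exists (M + 1) => t; exact: (h t).
Qed.

Lemma ultra_bounded_cvg (T : Type) (U : set_system T) (h : T -> R) (K : R) :
  UltraFilter U -> (forall p, `|h p| <= K) -> exists l : R, h @ U --> l.
Proof.
move=> uU hK; have pU := @ultra_proper _ _ uU.
have cK : compact (`[- K, K] : set R) by exact: segment_compact.
have [|l [_ cl]] := cK (h @ U) _.
  apply: (@filterS _ U _ setT) => [p _|]; last exact: filterT.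
  by rewrite /= in_itv/= -ler_norml hK.
exists l => N lN; rewrite /=.
have [//|UN] := in_ultra_setVsetC (h @^-1` N) uU.
have [y [Ny]] := cl (~` N) N UN lN.
by [].
Qed.

(** If there is no gap, the sets [almost_invariant S e] are all non-empty, and concatenating lists
    and taking the smaller e shows that they form a filter base. Along an ultrafilter containing
    them the means of each bounded f converge, and the limits form an invariant mean. *)
Lemma nonamenable_gap : ~ amenable R G -> exists (S : seq G) (e : R), 0 < e /\
  forall (xi : G -> R[i]) (D : {fset G}), (forall t, t \notin D -> xi t = 0) ->
    e * l2sq xi <= \sum_(s <- S) l2sq (gdiff xi s).
Proof.
move=> nam; apply: contrapT => H; apply: nam.
have AI S e : 0 < e -> almost_invariant S e !=set0.
  move=> e0; apply: contrapT => n0; apply: H; exists S, e; split=> // xi D xD.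
  by rewrite leNgt; apply/negP => h; apply: n0; exists (D, xi).
pose F : set_system ({fset G} * (G -> R[i])) :=
  [set P | exists S e, 0 < e /\ almost_invariant S e `<=` P].
have AIS S S' e e' : 0 < e -> 0 < e' ->
    almost_invariant (S ++ S') (Num.min e e') `<=`
    almost_invariant S e `&` almost_invariant S' e'.
  move=> e0 e0' p pA; have := almost_invariant_gt0 _ pA.
  rewrite lt_min e0 e0' => /(_ isT) Lp; case: pA => pD; rewrite big_cat/= => h.
  rewrite -(l2sqE pD) in Lp.
  have ge (r : seq G) : 0 <= \sum_(s <- r) l2sq (gdiff p.2 s).
    by apply: sumr_ge0 => s _; exact: l2sq_gdiff_ge0 pD.
  split; split=> //.
    apply: (@le_lt_trans _ _ (\sum_(s <- S) l2sq (gdiff p.2 s) + \sum_(s <- S') l2sq (gdiff p.2 s))).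
      by rewrite lerDl.
    by apply: lt_le_trans h _; rewrite ler_pM2r// ge_min lexx.
  apply: (@le_lt_trans _ _ (\sum_(s <- S) l2sq (gdiff p.2 s) + \sum_(s <- S') l2sq (gdiff p.2 s))).
    by rewrite lerDr.
  by apply: lt_le_trans h _; rewrite ler_pM2r// ge_min lexx orbT.
have pF : ProperFilter F.
  split.
    by move=> [S [e [e0 sub]]]; have [p /sub] := AI S e e0.
  split.
  - by exists [::], 1; split.
  - move=> P Q [S [e [e0 sP]]] [S' [e' [e0' sQ]]].
    exists (S ++ S'), (Num.min e e'); rewrite lt_min e0 e0'; split=> // p.
    by move=> /(AIS _ _ _ _ e0 e0')[/sP ? /sQ].
  - by move=> P Q PQ [S [e [e0 sP]]]; exists S, e; split=> // p /sP/PQ.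
have [U [uU FU]] := ultraFilterLemma pF.
have pU := @ultra_proper _ _ uU.
have UA S e : 0 < e -> U (almost_invariant S e).
  by move=> e0; apply: FU; exists S, e; split.
have cv f : bounded_fun f -> mean f @ U --> lim (mean f @ U).
  move=> /bounded_funP[K fK].
  have [l hl] := ultra_bounded_cvg uU (fun p => mean_bound p fK).
  exact: (cvgP l hl).
exists (fun f => lim (mean f @ U)); split.
- move=> f g bf bg; apply: cvg_lim => //.
  have -> : mean (f + g) = mean f \+ mean g by apply/funext => p; exact: meanD.
  by apply: cvgD; exact: cv.
- move=> c f bf; apply: cvg_lim => //.
  have -> : mean (fun t => c * f t) = (fun p => c * mean f p).
    by apply/funext => p; exact: meanZ.
  by apply: cvgM; [exact: cvg_cst|exact: cv].
- move=> f bf f0; apply: limr_ge; first exact: cv.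
  by apply: filterE => p; exact: mean_ge0.
- apply: cvg_lim => //; apply: (@cvg_trans _ ((fun=> 1 : R) @ U)); last exact: cvg_cst.
  apply: near_eq_cvg; apply: filterS (UA [::] 1 ltr01) => p pA.
  by rewrite (mean1 ltr01 pA).
move=> s f bf; have [K fK] := bounded_funP bf.
have K0 : 0 <= K by apply: le_trans (normr_ge0 _) (fK 1%g).
apply: cvg_lim => //.
have -> : mean (fun t => f (s^-1 * t)%g) =
    (fun p => (mean (fun t => f (s^-1 * t)%g) p - mean f p) + mean f p).
  by apply/funext => p; rewrite subrK.
rewrite -[lim _]add0r; apply: cvgD; last exact: cv.
apply/cvgrPdist_lt => e e0.
have K1 : 0 < 3 * (K + 1) by rewrite mulr_gt0// ltr_wpDl.
(* With tolerance h^2, [mean_shift] gives K (2 h + h) = 3 K h, which is below 3 (K + 1) h = e. *)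
pose h := e / (3 * (K + 1)); have h0 : 0 < h by rewrite divr_gt0.
have h20 : 0 < h ^+ 2 by rewrite exprn_gt0.
apply: filterS (UA [:: s] (h ^+ 2) h20) => p pA.
rewrite sub0r normrN.
have sS : s \in [:: s] by rewrite inE.
apply: le_lt_trans (mean_shift h20 h0 fK sS pA) _.
have -> : h^-1 * h ^+ 2 = h by rewrite expr2 mulrA mulVf ?mul1r// gt_eqF.
have -> : K * (2 * h + h) = 3 * K * h by ring.
have -> : e = 3 * (K + 1) * h by rewrite /h mulrC divfK// gt_eqF.
by rewrite ltr_pM2r// ltr_pM2l// ltrDl.
Qed.

End sums_over_group.

(** * The opaque ideal is non-zero *)

Section positive_part.
Variables (R : realType) (B : cstarAlgType R).
Implicit Types (a b k v : B).

(** With s the square root of 1 - k k, the element u = k + i s is unitary and s is its imaginary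
    part, so s has norm at most 1. This is what makes [cstar_sqrt] applicable to 1 - k k, and so
    produces |k|. *)
Lemma nrm_one_sub_sqr k : star k = k -> nrm k <= 1 -> nrm (1 - k * k) <= 1.
Proof.
move=> ks k1.
have kks : star (k * k) = k * k by rewrite starMr ks.
have kk1 : nrm (k * k) <= 1.
  by rewrite nrm_sa_sqr// exprn_ile1// nrm_ge0.
have [y [ys _ yy yc]] := cstar_sqrt kks kk1.
pose s := 1 - y; have ss : star s = s by rewrite starB star1 ys.
have ks_comm : k * s = s * k.
  by rewrite /s mulrBr mulrBl mul1r mulr1 (yc k)// mulrA.
rewrite -yy -/s nrm_sa_sqr// exprn_ile1// ?nrm_ge0//.
pose u := k + 'i%C *: s.
have su : star u = k - 'i%C *: s.
  rewrite starD starZ ks ss -scaleNr; congr (_ + _ *: _).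
  by apply: complexP; rewrite /= ?oppr0.
have uu : star u * u = 1.
  rewrite su mulrBl !mulrDr -!scalerAl -!scalerAr ks_comm scalerA.
  have -> : ('i%C * 'i%C : R[i]) = -1.
    by apply: complexP; rewrite /= ?mulr0 ?mul0r ?mulr1 ?addr0 ?sub0r ?oppr0.
  rewrite scaleN1r opprD opprK addrA addrK yy.
  by rewrite addrC subrK.
have nu : nrm u = 1.
  have := nrmX u; rewrite uu nrm1 => /esym/eqP.
  rewrite sqrf_eq1 => /orP[/eqP//|/eqP h].
  by have := nrm_ge0 u; rewrite h ler0N1.
have -> : s = (- 'i%C * (2^-1)%:C) *: (u - star u).
  rewrite su opprB [u + _]addrC /u addrA subrK -scalerDl scalerA.
  have -> : (- 'i%C * (2^-1)%:C * ('i%C + 'i%C) : R[i]) = 1.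
    apply: complexP => /=; first by field.
    by field.
  by rewrite scale1r.
have ci : cmod ('i%C : R[i]) = 1.
  by rewrite /cmod normc_def /= expr1n expr0n add0r sqrtr1.
rewrite nrmZ cmodM cmodN ci mul1r cmodR ger0_norm ?invr_ge0//.
rewrite ler_pdivrMl// mulr1; apply: le_trans (nrmD _ _) _.
by rewrite nrmN nrm_star nu.
Qed.

(* [a] is (twice) the positive part of [k] and [b = a |k|^(1/2)]; if [a] were
   0 then [1 + k = 1 - |k|] would have norm at most 1. *)
Lemma positive_part k : star k = k -> nrm k <= 1 -> 1 < nrm (1 + k) ->
  exists a b, [/\ b != 0, star a = a & b * star b = a * k * a].
Proof.
move=> ks k1 k1gt; pose x := 1 - k * k.
have xs : star x = x by rewrite starB star1 starMr ks.
(* Since 1 - x = k k, the element w = 1 - y below stands for |k|; the same lemma applied to y gives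
   d = 1 - z, a square root of w. *)
have [y [ys y1 yy yc]] := cstar_sqrt xs (nrm_one_sub_sqr ks k1).
have kx : k * x = x * k by rewrite /x mulrBr mulrBl mulr1 mul1r mulrA.
have ky := yc k kx.
have [z [zs _ zz zc]] := cstar_sqrt ys y1.
have kz := zc k ky.
pose w := 1 - y; pose d := 1 - z.
have ws : star w = w by rewrite starB star1 ys.
have ds : star d = d by rewrite starB star1 zs.
have ww : w * w = k * k by rewrite yy /x opprB addrCA subrr addr0.
have dd : d * d = w by exact: zz.
have kw : k * w = w * k by rewrite /w mulrBr mulrBl mulr1 mul1r ky.
have kd : k * d = d * k by rewrite /d mulrBr mulrBl mulr1 mul1r kz.
have wd : w * d = d * w by rewrite -dd mulrA.
pose a := w + k.
have as_ : star a = a by rewrite starD ws ks.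
have awk : a * w = a * k.
  by rewrite /a (mulrDl w k w) (mulrDl w k k) ww kw addrC.
exists a, (a * d); split=> //.
  (* From a d = 0 follow a w = 0 and a a = a w + a k = 2 a w = 0, so a = 0 and 1 + k = y. *)
  apply/eqP => ad0.
  have aw0 : a * w = 0 by rewrite -dd mulrA ad0 mul0r.
  have aa0 : a * a = 0 by rewrite {2}/a (mulrDr a w k) -awk aw0 addr0.
  have a0 : a = 0.
    apply/eqP; rewrite -nrm_eq0 -sqrf_eq0 -nrm_sa_sqr// aa0.
    by rewrite nrm0.
  have yE : 1 + k = y.
    have : w = - k by apply/eqP; rewrite -subr_eq0 opprK -/a a0.
    by rewrite /w => /(congr1 -%R); rewrite opprK opprB => <-; rewrite addrC subrK.
  by move: k1gt; rewrite yE ltNge y1.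
have -> : star (a * d) = d * a by rewrite starMr as_ ds.
by rewrite mulrA -(mulrA a d d) dd awk.
Qed.

(** The gap is known on finitely supported elements only, whereas the positive part to which it is
    applied involves a limit of polynomials and may leave the image of Cc. *)
Lemma state_form_ge0 (S : set B) phi (Q : B) : dense S -> state phi ->
  (forall a, S a -> 0 <= complex.Re (phi (star a * Q * a))) ->
  forall v, 0 <= complex.Re (phi (star v * Q * v)).
Proof.
move=> dS st SQ v; apply/ler_addgt0Pr => e e0.
pose K := nrm Q * (2 * nrm v + 1) + 1.
have K0 : 0 < K.
  by rewrite ltr_wpDl// mulr_ge0 ?addr_ge0 ?mulr_ge0 ?nrm_ge0.
have d0 : 0 < Num.min (e / K) 1 by rewrite lt_min divr_gt0 ?ltr01.
have [a Sa /ltW] := dense_nrmP dS v d0; rewrite le_min => /andP[va v1].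
have an : nrm a <= nrm v + 1.
  have -> : a = v - (v - a) by rewrite opprB addrCA subrr addr0.
  by apply: le_trans (nrmD _ _) _; rewrite nrmN lerD.
have h : nrm (star a * Q * a - star v * Q * v) <= e.
  have -> : star a * Q * a - star v * Q * v =
      star (a - v) * Q * a + star v * Q * (a - v).
    by rewrite starB !mulrBl mulrBr addrA subrK.
  apply: le_trans (nrmD _ _) _.
  have h1 : nrm (star (a - v) * Q * a) <= (e / K) * nrm Q * (nrm v + 1).
    apply: le_trans (nrmM _ _) _; apply: ler_pM; rewrite ?nrm_ge0//.
    apply: le_trans (nrmM _ _) _; rewrite nrm_star nrmB.
    by rewrite ler_wpM2r ?nrm_ge0.
  have h2 : nrm (star v * Q * (a - v)) <= nrm v * nrm Q * (e / K).
    apply: le_trans (nrmM _ _) _; rewrite [nrm (a - v)]nrmB.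
    apply: ler_pM; rewrite ?nrm_ge0//.
    by apply: le_trans (nrmM _ _) _; rewrite nrm_star.
  apply: le_trans (lerD h1 h2) _.
  have -> : e / K * nrm Q * (nrm v + 1) + nrm v * nrm Q * (e / K) =
      e / K * (K - 1) by rewrite /K; ring.
  rewrite mulrBr mulr1 divfK ?gt_eqF// gerBl.
  by rewrite divr_ge0 ?ltW.
have := le_trans (ler_Re_cmod _) (le_trans (state_dist _ _ st) h).
by rewrite creD creN; have := SQ a Sa; lra.
Qed.

End positive_part.

(** * The Laplacian under the evaluation states and under the invariant state *)

Section opaque_nonzero.
Variables (R : realType) (G : groupType) (X : ptopologicalType).
Variables (act : G -> X -> X) (B : cstarAlgType R).
Variables (iota : (G -> X -> R[i]) -> B) (mu : probability (borel X) R).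
Hypotheses (cX : compact [set: X]) (hX : hausdorff_space X).
Hypotheses (actP : homeo_action act) (freeP : free_action act).
Hypothesis muP : invariant_measure act mu.
Hypothesis fcp : full_crossed_product act iota.
Variables (S : seq G) (e : R).
Hypothesis e0 : 0 < e.
Hypothesis gap : forall (xi : G -> R[i]) (D : {fset G}),
  (forall t, t \notin D -> xi t = 0) ->
  e * l2sq xi <= \sum_(s <- S) l2sq (gdiff xi s).
Implicit Types (d : G -> X -> R[i]) (s t : G) (x : X).

Let CcM (a b : G -> X -> R[i]) : Cc a -> Cc b -> Cc (cc_mul act a b) := @Cc_mul _ _ _ _ actP a b.
Let SA := iota_imgP actP fcp.
Let T := iota_img iota.

(** The vector of iota d in the GNS space of phi_x, read in l^2(G). *)
Definition orbit_fun d x t : R[i] := d t (act t x).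

Lemma phi_sqn x d : Cc d ->
  psi_sqn (phi iota x) (iota d) = l2sq (orbit_fun d x).
Proof.
move=> Cd; have Csd := Cc_star actP Cd.
rewrite /psi_sqn -(fcp_star fcp Cd) -(fcpM fcp Csd Cd).
rewrite (phi_iota cX actP fcp x (CcM Csd Cd)).
have [D dD] := Cc_fset Cd.
rewrite (cc_star_mul1 _ _ _ dD) (@l2sqE _ _ _ D) => [|t tD].
  rewrite (raddf_sum (@complex.Re R : Rcomplex R -> R)).
  by apply: eq_bigr => t _; rewrite mulJc.
by rewrite /orbit_fun (dD _ tD).
Qed.

Definition unit_at s : B := iota (mon 1 s).

Let Cu s : Cc (mon (1 : X -> R[i]) s) := Cc_mon s (@continuous_c1 R X).

Let Tu s : T (unit_at s).
Proof. exact (ex_intro2 _ _ (mon 1 s) (Cu s) erefl). Qed.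

Let T1 : T 1 := ssub1 SA.

Let Tu1 s : T (unit_at s - 1).
Proof. exact: (ssubB SA (Tu s) T1). Qed.

Lemma unit_at_sub1_mul s d : Cc d -> exists2 d', Cc d' &
  (unit_at s - 1) * iota d = iota d' /\
  forall x, orbit_fun d' x = gdiff (orbit_fun d x) s.
Proof.
move=> Cd; have [a1 aM _] := actP.
exists (cc_mul act (mon 1 s) d + cc_scale (-1) d).
  exact (Cc_add (CcM (Cu s) Cd) (Cc_scale (-1) Cd)).
split.
  rewrite (fcpD fcp (CcM (Cu s) Cd) (Cc_scale (-1) Cd)) (fcpM fcp (Cu s) Cd).
  by rewrite (fcpZ fcp (-1) Cd) mulrBl mul1r scaleN1r.
move=> x; apply/funext => t; rewrite /orbit_fun /gdiff.
transitivity (cc_mul act (mon 1 s) d t (act t x) + cc_scale (-1) d t (act t x)).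
  by [].
rewrite cc_scaleE mulN1r mon_mul; congr (_ - _).
transitivity (1 * d (s^-1 * t)%g (act s^-1%g (act t x))); first by [].
by rewrite mul1r -aM.
Qed.

Definition laplacian : B :=
  \sum_(s <- S) star (unit_at s - 1) * (unit_at s - 1).

Lemma star_laplacian : star laplacian = laplacian.
Proof.
rewrite /laplacian; elim: (S) => [|s r IH]; first by rewrite big_nil star0.
by rewrite big_cons starD IH starMr starK.
Qed.

Lemma laplacian_gap x d : Cc d ->
  0 <= complex.Re (phi iota x
    (star (iota d) * (laplacian - e%:C *: 1) * iota d)).
Proof.
move=> Cd; have st := phi_state cX actP fcp x.
rewrite mulrBr mulrBl (stateB _ _ st) creD creN subr_ge0.
rewrite -scalerAr mulr1 -scalerAl (stateZ _ _ st) creRM.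
rewrite -/(psi_sqn _ (iota d)) (phi_sqn x Cd).
have [D dD] := Cc_fset Cd.
apply: le_trans (@gap _ D _) _ => [t /dD|].
  by rewrite /orbit_fun => ->.
rewrite /laplacian mulr_sumr mulr_suml (state_sum _ _ st).
rewrite (raddf_sum (@complex.Re R : Rcomplex R -> R)).
rewrite le_eqVlt; apply/orP; left; apply/eqP; apply: eq_bigr => s _.
have [d' Cd' [dE oE]] := unit_at_sub1_mul s Cd.
by rewrite -oE -(phi_sqn x Cd') -dE /psi_sqn starMr !mulrA.
Qed.

Let omega_pos := descend_positive actP fcp (omega_positive cX actP muP).

Lemma omega_unit_at s : descend iota (omega mu) (unit_at s) = 1.
Proof.
rewrite (descendE fcp _ (Cu s)) (omega_mon mu cX s (@continuous_c1 R X)).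
exact: cint1.
Qed.

Lemma omega_one : descend iota (omega mu) 1 = 1.
Proof. by rewrite -(iota1 actP fcp) omega_unit_at. Qed.

(** As u_s is unitary, each term is (1 - star u_s) - (u_s - 1), and omega is 1 at 1, u_s and star
    u_s. Membership in the image goes along in the induction because the functional is additive only
    there. *)
Lemma omega_laplacian : T laplacian /\ descend iota (omega mu) laplacian = 0.
Proof.
rewrite /laplacian; elim: (S) => [|s r [Tr r0]].
  have T0 : T 0 by rewrite -(scale0r (1 : B)); exact: (ssubZ SA).
  rewrite big_nil; split=> //.
  have := posZ omega_pos 0 T1; by rewrite scale0r mul0r.
have Ts := ssub_star SA (Tu s); have Tv := ssub_star SA (Tu1 s).
have Tm := ssubM SA Tv (Tu1 s).
rewrite big_cons; split; first exact: (ssubD SA).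
rewrite (posD omega_pos Tm Tr) r0 addr0.
have uu : star (unit_at s) * unit_at s = 1.
  rewrite -(fcp_star fcp (Cu s)) -(fcpM fcp (Cc_star actP (Cu s)) (Cu s)).
  rewrite mon_star_mul -(iota1 actP fcp); congr (iota (mon _ _)).
  by apply/funext => x; rewrite cmod1 expr1n.
have -> : star (unit_at s - 1) * (unit_at s - 1) =
    (1 - star (unit_at s)) - (unit_at s - 1).
  by rewrite starB star1 mulrBr mulr1 mulrBl mul1r uu !opprB addrC.
have Ta : T (1 - star (unit_at s)) by exact: (ssubB SA).
rewrite (posB SA omega_pos Ta (Tu1 s)) (posB SA omega_pos T1 Ts).
rewrite (posB SA omega_pos (Tu s) T1) (pos_star SA omega_pos (Tu s)).
by rewrite omega_unit_at omega_one rmorph1 !subrr.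
Qed.

Lemma opaque_ideal_nonzero :
  exists2 b : B, b != 0 & opaque_ideal (fun f => iota (cc_const f)) b.
Proof.
pose Q := laplacian - e%:C *: 1.
(* This scales k = - l Q into the unit ball; the summand 1 keeps l defined when Q = 0. *)
pose l := (nrm Q + 1)^-1.
have nQ : 0 < nrm Q + 1 by rewrite ltr_wpDl ?nrm_ge0.
have l0 : 0 < l by rewrite invr_gt0.
pose k := (- l)%:C *: Q.
have Qs : star Q = Q by rewrite starB star_laplacian starZr star1.
have ks : star k = k by rewrite starZr Qs.
have k1 : nrm k <= 1.
  rewrite nrmZr normrN (ger0_norm (ltW l0)) ler_pdivrMl// mulr1.
  by rewrite lerDl.
have [TL L0] := omega_laplacian.
have Te : T (e%:C *: 1) by exact: (ssubZ SA).
have TQ : T Q by exact: (ssubB SA).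
have Tk : T k by exact: (ssubZ SA).
(* The value of omega at Q is - e, so its value at 1 + k is 1 + l e, and omega is dominated by the
   norm. *)
have k1gt : 1 < nrm (1 + k).
  apply: lt_le_trans (positive_le_nrm cX actP fcp omega_pos omega_one
    (ssubD SA T1 Tk)).
  rewrite (posD omega_pos T1 Tk) (posZ omega_pos _ TQ).
  rewrite (posB SA omega_pos TL Te) (posZ omega_pos _ T1) L0 omega_one.
  rewrite sub0r mulr1.
  have -> : (1 + (- l)%:C * - e%:C : R[i]) = (1 + l * e)%:C.
    by apply: complexP => /=; ring.
  rewrite cmodR ger0_norm; first by rewrite ltrDl mulr_gt0.
  by rewrite addr_ge0// mulr_ge0// ltW.
have [a [b [bn as_ bb]]] := positive_part ks k1 k1gt.
exists b => // x _; apply: (JB_of_phi cX hX actP freeP fcp).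
have st := phi_state cX actP fcp x.
have [_ pos _] := st.
have := pos (star b); rewrite starK => b0.
suff : complex.Re (phi iota x (b * star b)) <= 0.
  case/ge0cP: b0 => i0 r0 r1; apply: complexP => //=.
  by apply/eqP; rewrite eq_le r0 r1.
(* Here phi_x (b . star b) = - l phi_x (a . Q . a), and the gap makes the last value nonnegative. *)
rewrite bb /k -scalerAr -scalerAl (stateZ _ _ st) creRM mulNr oppr_le0.
rewrite mulr_ge0 ?(ltW l0)// -{1}as_.
apply: (state_form_ge0 (dense_iota_img fcp) st) => _ [d Cd <-].
exact: laplacian_gap.
Qed.

End opaque_nonzero.

Theorem theorem4p1 (R : realType) (G : groupType) (X : ptopologicalType)
    (act : G -> X -> X)
    (B : cstarAlgType R) (iota : (G -> X -> R[i]) -> B) :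
  ~ amenable R G ->
  compact [set: X] -> hausdorff_space X ->
  homeo_action act -> free_action act ->
  (exists mu : probability (borel X) R,
     regular_measure mu /\ invariant_measure act mu) ->
  full_crossed_product act iota ->
  let j := fun f : X -> R[i] => iota (cc_const f) in
  opaque_ideal j = gray_ideal j /\ opaque_ideal j <> [set 0].
Proof.
move=> nam cX hX actP freeP [mu [_ muP]] fcp j; split.
  rewrite /opaque_ideal /gray_ideal; congr bigcap; apply/esym.
  apply/seteqP; split=> // x _.
  exact: (free_pointT cX hX actP freeP fcp).
have [S [e [e0 gap]]] := nonamenable_gap nam.
have [b b0 bo] := opaque_ideal_nonzero cX hX actP freeP muP fcp e0 gap.
by move=> o0; move: bo; rewrite -/j o0 => /eqP; rewrite (negbTE b0).
Qed.
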